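(* Let $(M,F)$ be a conic pseudo-Finsler surface with $F$ defined on the conic sub-bundle $\mathcal A$, let $\phi:\mathcal A\to\mathbb R$ be a smooth function positively homogeneous of degree $0$ in $y$ with $\sigma+\varepsilon-(\phi_{;2})^2\neq0$ on $\mathcal A$, where $\sigma=\phi_{;2;2}+\varepsilon\mathcal I\phi_{;2}+2(\phi_{;2})^2$, and let $\overline F=e^{\phi}F$. Let $S,\overline S$ be the geodesic sprays and $G^i,\overline G^i$ the geodesic spray coefficients of $F,\overline F$. Then the following assertions are equivalent: (i) $S$ and $\overline S$ are projectively equivalent; (ii) $\phi_{;2}\phi_{,1}+\phi_{,1;2}=2\phi_{,2}$; (iii) $\overline G^i=G^i+\tfrac12F\phi_{,1}\,y^i$.
   Context: Let $M$ be a smooth 2-dimensional manifold, $(x^1,x^2)$ local coordinates and $(x^i,y^i)$ the induced coordinates on $TM$; all formulas are in such a coordinate system and repeated indices are summed over $\{1,2\}$. Write $\partial_i=\partial/\partial x^i$, $\dot\partial_i=\partial/\partial y^i$. A function is $h(r)$ if it is positively homogeneous of degree $r$ in $y$. A conic sub-bundle is a non-empty open subset $\mathcal A\subset TM\setminus 0$ projecting onto $M$ and closed under multiplication by positive scalars. A conic pseudo-Finsler metric on $M$ is a smooth $h(1)$ function $F:\mathcal A\to\mathbb R$ such that $g_{ij}=\tfrac12\dot\partial_i\dot\partial_jF^2$ is non-degenerate at each point of $\mathcal A$; $(g^{ij})$ is the inverse matrix. A conic pseudo-Finsler surface is equipped with its modified Berwald frame: $F$ is nowhere zero on $\mathcal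 A$, $\ell_i=\dot\partial_iF$, $\ell^i=y^i/F$, $\varepsilon\in\{1,-1\}$ (the signature) is the sign of $\det(g_{ij})$, $m_1=-\sqrt{\varepsilon\det(g_{ij})}\,\ell^2$, $m_2=\sqrt{\varepsilon\det(g_{ij})}\,\ell^1$, $m^i=g^{ij}m_j$; thus $g_{ij}=\ell_i\ell_j+\varepsilon m_im_j$, $\ell^im_i=0$, $m^im_i=\varepsilon$. The main scalar $\mathcal I$ is defined by $F\,C_{ijk}=\mathcal I\,m_im_jm_k$, where $C_{ijk}=\tfrac12\dot\partial_kg_{ij}$. The geodesic spray of $F$ is $S=y^i\partial_i-2G^i\dot\partial_i$ with $G^i=\tfrac14g^{ij}(y^k\dot\partial_j\partial_kF^2-\partial_jF^2)$; $G^j_i=\dot\partial_iG^j$ and $\delta_i=\partial_i-G^j_i\dot\partial_j$. $\overline S,\overline G^i$ are defined in the same way from $\overline F$ (the condition $\sigma+\varepsilon-(\phi_{;2})^2\ne0$ guarantees that $\overline F$ is a conic pseudo-Finsler metric). Two sprays $S,\overline S$ are projectively equivalent if there is an $h(1)$ function $\mathcal P:\mathcal A\to\mathbb R$ with $\overline S=S-2\mathcal P\,y^i\dot\partial_i$, i.e. $\overline G^i=G^i+\mathcal P y^i$. For a smooth function $f$ on $\mathcal A$: $f_{;2}:=\varepsilon F(\dot\partial_if)m^i$, $f_{,1}:=(\delta_if)\ell^i$, $f_{,2}:=\varepsilon(\delta_if)m^i$, and iterated symbols are read left to right, e.g. $f_{;2;2}=(f_{;2})_{;2}$, $f_{,1;2}=(f_{,1})_{;2}$.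 *)

(* Defs.v *)
From HB Require Import structures.
From mathcomp Require Import all_boot all_order all_algebra.
From mathcomp Require Import all_classical all_reals all_analysis.

Set Implicit Arguments.
Unset Strict Implicit.
Unset Printing Implicit Defensive.

Import Order.TTheory GRing.Theory Num.Theory.
Import numFieldNormedType.Exports.

Local Open Scope classical_set_scope.
Local Open Scope ring_scope.

(** * Smooth maps between open subsets of normed spaces *)

Section Smooth.
Context {R : realType} {V W : normedModType R}.

Fixpoint Cn (n : nat) (U : set V) (f : V -> W) : Prop :=
  if n is m.+1 then
    (forall x, U x -> differentiable f x) /\ (forall v, Cn m U ('D_v f))
  else forall x, U x -> {for x, continuous f}.

Definition smooth_on (U : set V) (f : V -> W) : Prop := forall n, Cn n U f.

End Smooth.

(** * Smooth surfaces *)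

(* [param a] inverts [coord a] on the image of the chart domain; its values
   elsewhere are irrelevant.  The atlas need not be maximal, so the maximal one
   is included. *)
Record surface (R : realType) := Surface {
  points :> topologicalType;
  index : Type;
  dom : index -> set points;
  coord : index -> points -> 'rV[R]_2;
  param : index -> 'rV[R]_2 -> points;
  points_hausdorff : hausdorff_space points;
  points_second_countable : @second_countable points;
  dom_open : forall a, open (dom a);
  dom_cover : forall p, exists a, dom a p;
  coordK : forall a p, dom a p -> param a (coord a p) = p;
  coord_continuous : forall a p, dom a p -> {for p, continuous (coord a)};
  image_open : forall a, open (coord a @` dom a);
  param_continuous : forall a x,
    (coord a @` dom a) x -> {for x, continuous (param a)};
  transition_smooth : forall a b,
    smooth_on (coord a @` (dom a `&` dom b)) (coord b \o param a) }.

Definition transition (R : realType) (M : surface R) (a b : index M) :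
  'rV[R]_2 -> 'rV[R]_2 := coord b \o param a.

(** * The tangent bundle *)

(* A tangent vector at p is given by its components in every chart around p,
   related by the differentials of the transition maps; components in the charts
   that miss p are set to 0, so that equal vectors are equal records. *)
Record tangent (R : realType) (M : surface R) := Tangent {
  base : M;
  comp : index M -> 'rV[R]_2;
  comp_transition : forall a b, dom a base -> dom b base ->
    comp b = 'd (transition a b) (coord a base) (comp a);
  comp_out : forall a, ~ dom a base -> comp a = 0 }.

Arguments base {R M}.
Arguments comp {R M}.

Section TangentBundle.
Context {R : realType} {M : surface R}.
Implicit Types (a b : index M) (t : tangent M) (k : R).

Lemma tangent_eq t u : base t = base u -> comp t = comp u -> t = u.
Proof.
case: t u => p v h1 h2 [q w h3 h4] /= epq evw; subst q w.
by congr Tangent; exact: Prop_irrelevance.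
Qed.

Lemma tscale_transition k t a b : dom a (base t) -> dom b (base t) ->
  k *: comp t b = 'd (transition a b) (coord a (base t)) (k *: comp t a).
Proof. by move=> pa pb; rewrite linearZ -comp_transition. Qed.

Lemma tscale_out k t a : ~ dom a (base t) -> k *: comp t a = 0.
Proof. by move=> /comp_out ->; rewrite scaler0. Qed.

Definition tscale k t : tangent M :=
  @Tangent R M (base t) (fun a => k *: comp t a)
    (@tscale_transition k t) (@tscale_out k t).

Definition tcoord a t : 'rV[R]_2 * 'rV[R]_2 := (coord a (base t), comp t a).

(* The coordinate image of the part of A lying over the domain of the chart. *)
Definition chart_set a (A : set (tangent M)) : set ('rV[R]_2 * 'rV[R]_2) :=
  tcoord a @` [set t | A t /\ dom a (base t)].

(* The coordinate expression f(x, y) of a function f on TM; it is 0 for x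
   outside the image of the chart. *)
Definition chart_expr a (f : tangent M -> R) (z : 'rV[R]_2 * 'rV[R]_2) : R :=
  xget 0 [set f t | t in [set t | dom a (base t) /\ tcoord a t = z]].

Lemma tcoord_inj a t u : dom a (base t) -> dom a (base u) ->
  tcoord a t = tcoord a u -> t = u.
Proof.
move=> ta ua [xe ye].
have bE : base t = base u by rewrite -(coordK ta) xe coordK.
apply: tangent_eq => //; apply/funext => b.
have [tb|tb] := pselect (dom b (base t)).
  by rewrite (comp_transition ta tb) (comp_transition ua) -?bE// ye.
by rewrite !comp_out// -bE.
Qed.

Lemma transition_differentiable a b p : dom a p -> dom b p ->
  differentiable (transition a b) (coord a p).
Proof. by move=> pa pb; have [h _] := transition_smooth a b 1; apply: h; exists p. Qed.

Lemma diff_chain (f g : 'rV[R]_2 -> 'rV[R]_2) x y : f x = y ->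
  differentiable f x -> differentiable g y ->
  differentiable (g \o f) x /\ 'd (g \o f) x = 'd g y \o 'd f x :> (_ -> _).
Proof.
move=> <- df dg; split; [exact: differentiable_comp|exact: diff_comp].
Qed.

Lemma transition_comp a b c p : dom a p -> dom b p -> dom c p ->
  'd (transition a c) (coord a p) =
  'd (transition b c) (coord b p) \o 'd (transition a b) (coord a p)
  :> (_ -> _).
Proof.
move=> pa pb pc.
have ab := transition_differentiable pa pb.
have ac := transition_differentiable pa pc.
have bc := transition_differentiable pb pc.
have bE : transition a b (coord a p) = coord b p.
  by congr (coord b _); exact: coordK.
have [abc dE] := diff_chain bE ab bc.
rewrite -dE; apply/funext => v.
transitivity ('D_v (transition a c) (coord a p)).
  exact: esym (deriveE v ac).
transitivity ('D_v (transition b c \o transition a b) (coord a p)).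
  apply: near_eq_derive.
  have : \forall x \near coord a p, dom b (param a x).
    apply: (@param_continuous _ M a (coord a p)); first by exists p.
    by rewrite coordK//; apply: open_nbhs_nbhs; split => //; exact: dom_open.
  by apply: filterS => x bx; rewrite /transition /= coordK.
exact: deriveE v abc.
Qed.

Lemma transition_id a p v : dom a p -> 'd (transition a a) (coord a p) v = v.
Proof.
move=> pa; rewrite -deriveE; last exact: transition_differentiable.
transitivity ('D_v id (coord a p)); last exact: derive_id.
apply: near_eq_derive.
have : \forall x \near coord a p, (coord a @` dom a) x.
  by apply: open_nbhs_nbhs; split; [exact: image_open|exists p].
by apply: filterS => _ [q aq <-]; rewrite /transition /= coordK.
Qed.

Lemma tcoord_surj a x y : (coord a @` dom a) x ->
  exists2 t : tangent M, dom a (base t) & tcoord a t = (x, y).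
Proof.
move=> [p pa <-{x}].
pose v b : 'rV[R]_2 :=
  if pselect (dom b p) then 'd (transition a b) (coord a p) y else 0.
have v_in b : dom b p -> v b = 'd (transition a b) (coord a p) y.
  by move=> pb; rewrite /v; case: pselect.
have v_out b : ~ dom b p -> v b = 0 by move=> pb; rewrite /v; case: pselect.
have v_trans b c : dom b p -> dom c p ->
    v c = 'd (transition b c) (coord b p) (v b).
  move=> pb pc; rewrite (v_in _ pb) (v_in _ pc).
  exact: (congr1 (fun f => f y) (transition_comp pa pb pc)).
exists (Tangent v_trans v_out) => //; congr pair.
by rewrite [LHS](v_in _ pa); exact: transition_id.
Qed.

Lemma chart_exprE a (f : tangent M -> R) t :
  dom a (base t) -> chart_expr a f (tcoord a t) = f t.
Proof.
move=> ta; rewrite /chart_expr; case: xgetP => [r _ [u [ua ue] <-]|].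
  by rewrite (tcoord_inj ua ta ue).
by move=> /(_ (f t)) []; exists t.
Qed.

(* Openness of A refers to the manifold topology of TM. *)
Definition conic_subbundle (A : set (tangent M)) : Prop :=
  [/\ A !=set0,
      forall a, open (chart_set a A),
      forall t a, A t -> dom a (base t) -> comp t a != 0,
      base @` A = [set: M]
    & forall k t, 0 < k -> A t -> A (tscale k t)].

Definition smooth_fun (A : set (tangent M)) (f : tangent M -> R) : Prop :=
  forall a, smooth_on (chart_set a A) (chart_expr a f).

Definition homogeneous (r : nat) (A : set (tangent M)) (f : tangent M -> R) :
  Prop := forall k t, 0 < k -> A t -> f (tscale k t) = k ^+ r * f t.

End TangentBundle.

(** * Finsler geometry in coordinates *)

(* F and h are coordinate expressions of functions on TM, z = (x, y), and the
   indices 1, 2 are 0, 1 : 'I_2. *)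
Section Coordinates.
Context {R : realType}.
Local Notation TU := ('rV[R]_2 * 'rV[R]_2)%type.
Implicit Types (F h : TU -> R) (z : TU) (i j k : 'I_2).

Definition dx i h : TU -> R := 'D_(delta_mx 0 i, 0) h.
Definition dy i h : TU -> R := 'D_(0, delta_mx 0 i) h.

Definition sqF F z : R := F z ^+ 2.

Definition metric F z : 'M[R]_2 := \matrix_(i, j) (2^-1 * dy i (dy j (sqF F)) z).

Definition inv_metric F z : 'M[R]_2 := invmx (metric F z).

Definition cartan F i j k z : R := 2^-1 * dy k (fun w => metric F w i j) z.

(* Locally constant where the metric is smooth and non-degenerate. *)
Definition signature F z : R := Num.sg (\det (metric F z)).

Definition ell_up F i z : R := z.2 0 i / F z.

(* The sign of the covector m depends on the orientation of the coordinates, and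
   so does the sign of h_{;2}, of h_{,2} and of the main scalar. *)
Definition m_low F i z : R :=
  let s := Num.sqrt (signature F z * \det (metric F z)) in
  if i == 0 then - s * ell_up F 1 z else s * ell_up F 0 z.

Definition m_up F i z : R := \sum_j inv_metric F z i j * m_low F j z.

(* Definite description; 0 if there is no such scalar. *)
Definition main_scalar F z : R :=
  xget 0 [set I | forall i j k,
    F z * cartan F i j k z = I * m_low F i z * m_low F j z * m_low F k z].

Definition spray_coef F i z : R :=
  4^-1 * \sum_j inv_metric F z i j *
    (\sum_k z.2 0 k * dy j (dx k (sqF F)) z - dx j (sqF F) z).

(* The components of S = y^i d/dx^i - 2 G^i d/dy^i. *)
Definition spray F z : TU := (z.2, \row_i (- 2 * spray_coef F i z)).

(* [connection F j i] is G^j_i. *)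
Definition connection F j i : TU -> R := dy i (spray_coef F j).

Definition delta F i h z : R := dx i h z - \sum_j connection F j i z * dy j h z.

(* h_{;2}, h_{,1} and h_{,2} *)
Definition semi2 F h z : R :=
  signature F z * F z * \sum_i dy i h z * m_up F i z.
Definition comma1 F h z : R := \sum_i delta F i h z * ell_up F i z.
Definition comma2 F h z : R := signature F z * \sum_i delta F i h z * m_up F i z.

Definition sigma F h z : R :=
  semi2 F (semi2 F h) z + signature F z * main_scalar F z * semi2 F h z
  + 2 * semi2 F h z ^+ 2.

End Coordinates.

(** * Conic pseudo-Finsler surfaces *)

Section PseudoFinsler.
Context {R : realType} {M : surface R}.
Implicit Types (A : set (tangent M)) (F phi P : tangent M -> R).

Definition conic_pseudo_finsler A F : Prop :=
  [/\ conic_subbundle A, smooth_fun A F, homogeneous 1 A F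
    & forall a z, chart_set a A z -> \det (metric (chart_expr a F) z) != 0].

Definition projectively_equivalent A F F' : Prop :=
  exists2 P, homogeneous 1 A P &
    forall a z, chart_set a A z ->
      spray (chart_expr a F') z =
      spray (chart_expr a F) z - (2 * chart_expr a P z) *: (0, z.2).

Definition conformal_change F phi : tangent M -> R := fun t => expR (phi t) * F t.

End PseudoFinsler.

(* Main.v *)
From HB Require Import structures.
Require Import Defs.
From mathcomp Require Import all_boot all_order all_algebra.
From mathcomp Require Import all_classical all_reals all_analysis.
From mathcomp Require Import ring lra.

Set Implicit Arguments.
Unset Strict Implicit.
Unset Printing Implicit Defensive.

Import Order.TTheory GRing.Theory Num.Theory.
Import numFieldNormedType.Exports.

Local Open Scope classical_set_scope.
Local Open Scope ring_scope.

(** Write L = F^2, let S be the spray of F and T = S phi = F phi_{,1}.  The spray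
    of F is determined by the Euler-Lagrange equations of L, whose left-hand side
    for any function K is d.i (S K) - 2 delta_i K; for L this and Euler's theorem
    give S L = 0 and delta_i L = 0.  Taking K = Fbar^2 = e^(2 phi) L, one finds that
    the Euler-Lagrange expression of Fbar^2 along S is

      2 (T d.i Fbar^2 + Fbar^2 d.i T - 2 Fbar^2 delta_i phi),

    and Gbar^i = G^i + P y^i means that this equals 2 P d.i Fbar^2.  Contraction
    with y^i forces P = T / 2, which gives (i) -> (iii), and what remains is a single
    scalar equation transversal to y, which is (ii).  The metric of Fbar is
    non-degenerate because its determinant is that of F times
    e^(4 phi) eps (sigma + eps - (phi_{;2})^2).  For (iii) -> (i), T / 2 has to be
    a function on A independent of the chart: the Euler-Lagrange equations are
    covariant under coordinate changes, hence so is S. *)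

(** The frame is eliminated through two formulas. Since g_ij y^j = F d.i F, raising the index of m
    gives m^i = (eps / vol) (-d.2 F, d.1 F) with vol = sqrt(eps det g). Hence eps m^i u_i is 1 / vol
    times the wedge product of the fibre differential dF with the covector u, and no inverse metric
    is left in h_{;2} or h_{,2}. A covector killed by y vanishes as soon as its wedge product with
    dF does, because y^i d.i F = F is nonzero; this is why the single equation (ii) carries both
    components of the spray equation. The second formula is d.k vol = eps I m_k vol / F.
    Differentiating phi_{;2} once more therefore produces -eps I phi_{;2}, which the middle term of
    sigma cancels. So sigma + eps - (phi_{;2})^2 can be compared with the determinant of the new
    metric by an identity between the second-order fibre derivatives of F and phi, valid modulo
    Euler's relations. All of this takes place in one coordinate domain and, for (ii) and (iii), at
    one point. Different charts meet only in the construction of the factor for (i). *)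

(** * Directional derivatives of scalar functions *)

Section DerivAt.
Context {R : realType} {V : normedModType R}.
Implicit Types (f g : V -> R) (z v : V) (U : set V).

(** Differentiability travels together with the value, since the chain rule needs it. Derivatives of
    compound expressions are thus assembled rule by rule, and the resulting value is simplified at
    the end with [deriv_at_eq]. *)
Definition deriv_at f z v (d : R) : Prop := differentiable f z /\ 'D_v f z = d.

Lemma deriv_at_eq f z v d d' : deriv_at f z v d -> d = d' -> deriv_at f z v d'.
Proof. by move=> ? <-. Qed.

Lemma deriv_at_self f z v : differentiable f z -> deriv_at f z v ('D_v f z).
Proof. by []. Qed.

Lemma deriv_at_cst z v (c : R) : deriv_at (fun=> c) z v 0.
Proof. by split; [exact: differentiable_cst|exact: derive_cst]. Qed.

Lemma deriv_atD f g z v a b : deriv_at f z v a -> deriv_at g z v b ->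
  deriv_at (fun w => f w + g w) z v (a + b).
Proof.
move=> [df <-] [dg <-]; split; first exact: (differentiableD df dg).
by rewrite [LHS](@deriveD _ _ _ f g)//; exact: diff_derivable.
Qed.

Lemma deriv_atN f z v a : deriv_at f z v a -> deriv_at (fun w => - f w) z v (- a).
Proof.
move=> [df <-]; split; first exact: (differentiableN df).
by rewrite [LHS](@deriveN _ _ _ f)//; exact: diff_derivable.
Qed.

Lemma deriv_atM f g z v a b : deriv_at f z v a -> deriv_at g z v b ->
  deriv_at (fun w => f w * g w) z v (a * g z + f z * b).
Proof.
move=> [df <-] [dg <-]; split; first exact: (differentiableM df dg).
rewrite [LHS](@deriveM _ _ f g); [|exact: diff_derivable..].
by rewrite /GRing.scale /= addrC (mulrC (g z)).
Qed.

Lemma deriv_at_comp (h : R -> R) f z v a b : deriv_at f z v a ->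
  is_derive (f z) 1 h b -> deriv_at (fun w => h (f w)) z v (b * a).
Proof.
move=> [df <-] dh.
have dh' : differentiable h (f z).
  by apply/derivable1_diffP; exact: (@ex_derive _ _ _ _ _ _ _ dh).
split; first exact: (differentiable_comp df dh').
rewrite deriveE; last exact: (differentiable_comp df dh').
rewrite [LHS](congr1 (fun F => F v) (diff_comp df dh')) /= deriveE //.
rewrite -(@derive_val _ _ _ _ _ _ _ dh) deriveE//.
by rewrite -[X in 'd h _ X]mulr1 [LHS]linearZ /= mulrC.
Qed.

Lemma deriv_atV f z v a : f z != 0 -> deriv_at f z v a ->
  deriv_at (fun w => (f w)^-1) z v (- a / f z ^+ 2).
Proof.
move=> fz0 [df <-]; split.
  exact: (@differentiableV _ _ f z df fz0).
rewrite [LHS](@deriveV _ _ f z v fz0 (diff_derivable df)).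
by rewrite /GRing.scale /= !mulNr mulrC.
Qed.


(** The first-order expansion of f at z is also one of g, and uniqueness of the differential
    identifies its linear part. *)
Lemma near_eq_differentiable f g z : (\near z, f z = g z) ->
  differentiable f z -> differentiable g z.
Proof.
move=> fg df; have fgz := nbhs_singleton fg.
have H : g \o shift z = cst (g z) + 'd f z +o_ 0 id.
  apply/eqaddoP => _/posnumP[e].
  have /diff_locally/eqaddoP/(_ e%:num (gt0 e)) := df.
  have : \forall x \near 0, f (x + z) = g (x + z).
    by move: fg; rewrite (near_shift 0) /=; apply: filterS => x; rewrite subr0.
  by apply: filterS2 => x /= fx; rewrite !fctE /= fx fgz.
apply/diff_locallyP.
have dE := diff_unique (diff_continuous df) H.
by rewrite dE; split => //; exact: diff_continuous.
Qed.

Lemma deriv_at_near f g z v a : (\near z, f z = g z) ->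
  deriv_at f z v a -> deriv_at g z v a.
Proof.
move=> fg [df <-]; split; last by apply/esym; exact: near_eq_derive.
exact: near_eq_differentiable df.
Qed.

Lemma deriv_at_on U f g z v a : open U -> U z -> (forall w, U w -> f w = g w) ->
  deriv_at f z v a -> deriv_at g z v a.
Proof.
move=> oU Uz fg; apply: deriv_at_near.
by have := open_nbhs_nbhs (conj oU Uz); apply: filterS.
Qed.

Lemma deriv_at_lin (h : {linear V -> R}) z v : continuous h -> deriv_at h z v (h v).
Proof.
move=> hc; split; first exact: linear_differentiable.
by rewrite deriveE ?diff_lin//; exact: linear_differentiable.
Qed.

End DerivAt.

(** * Closure properties of smooth functions *)

Section Cn.
Context {R : realType} {V : normedModType R}.
Implicit Types (z v : V) (U : set V).

Lemma near_eq_on (W : normedModType R) (f g : V -> W) U z : open U -> U z ->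
  (forall w, U w -> f w = g w) -> \near z, f z = g z.
Proof.
by move=> oU Uz fg; have := open_nbhs_nbhs (conj oU Uz); apply: filterS.
Qed.

Lemma Cn_ext n U (f g : V -> R) : open U -> (forall w, U w -> f w = g w) ->
  Cn n U f -> Cn n U g.
Proof.
move=> oU; elim: n f g => [|n IH] f g fg /=.
  move=> cf z Uz; have nfg := near_eq_on oU Uz fg.
  suff : g @ z --> g z by [].
  rewrite -(fg z Uz).
  by apply: cvg_trans (cf z Uz); apply: near_eq_cvg.
move=> [df Cf]; split=> [z Uz|v].
  by apply: near_eq_differentiable (df z Uz); exact: (near_eq_on oU Uz fg).
apply: IH (Cf v) => z Uz; apply: near_eq_derive.
exact: (near_eq_on oU Uz fg).
Qed.

Lemma CnW (W : normedModType R) n U (f : V -> W) : Cn n.+1 U f -> Cn n U f.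
Proof.
elim: n f => [|n IH] f; first by move=> [df _] z Uz; apply: differentiable_continuous; exact: df.
by move=> [df Cf]; split=> // v; apply: IH; exact: Cf.
Qed.

Lemma Cn_cst n U (c : R) : Cn n U (fun=> c).
Proof.
elim: n c => [|n IH] c /=; first by move=> z _; exact: cvg_cst.
split=> [z _|v]; first exact: differentiable_cst.
by rewrite (_ : 'D_v _ = fun=> 0)//; apply/funext => z; exact: derive_cst.
Qed.

Lemma Cn_lin n U (h : {linear V -> R}) : continuous h -> Cn n U h.
Proof.
case: n => [|n] hc /=; first by move=> z _; exact: hc.
split=> [z _|v]; first exact: linear_differentiable.
rewrite (_ : 'D_v _ = fun=> h v); first exact: Cn_cst.
by apply/funext => z; exact: (deriv_at_lin z v hc).2.
Qed.

Lemma CnD n U (f g : V -> R) : open U -> Cn n U f -> Cn n U g ->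
  Cn n U (fun w => f w + g w).
Proof.
move=> oU; elim: n f g => [|n IH] f g.
  by move=> cf cg z Uz; apply: cvgD; [exact: cf|exact: cg].
move=> [df Cf] [dg Cg]; split=> [z Uz|v].
  by have [] := deriv_atD (deriv_at_self 0 (df z Uz)) (deriv_at_self 0 (dg z Uz)).
apply: Cn_ext (IH _ _ (Cf v) (Cg v)) => // z Uz; apply/esym.
by have [] := deriv_atD (deriv_at_self v (df z Uz)) (deriv_at_self v (dg z Uz)).
Qed.

(** The product rule contains f and g undifferentiated, so the induction hypothesis is applied to
    them after lowering their order with [CnW]; inverses and exponentials follow the same
    pattern. *)
Lemma CnM n U (f g : V -> R) : open U -> Cn n U f -> Cn n U g ->
  Cn n U (fun w => f w * g w).
Proof.
move=> oU; elim: n f g => [|n IH] f g.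
  by move=> cf cg z Uz; apply: cvgM; [exact: cf|exact: cg].
move=> Cf' Cg'; have [df Cf] := Cf'; have [dg Cg] := Cg'; split=> [z Uz|v].
  by have [] := deriv_atM (deriv_at_self 0 (df z Uz)) (deriv_at_self 0 (dg z Uz)).
apply: (Cn_ext (f := fun w => 'D_v f w * g w + f w * 'D_v g w)) => // [z Uz|].
  apply/esym.
  by have [] := deriv_atM (deriv_at_self v (df z Uz)) (deriv_at_self v (dg z Uz)).
by apply: CnD => //; [exact: IH (Cf v) (CnW Cg')|exact: IH (CnW Cf') (Cg v)].
Qed.

Lemma CnN n U (f : V -> R) : open U -> Cn n U f -> Cn n U (fun w => - f w).
Proof.
move=> oU Cf; apply: (Cn_ext (f := fun w => -1 * f w)) => // [w _|].
  by rewrite mulN1r.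
by apply: CnM => //; exact: Cn_cst.
Qed.

Lemma CnV n U (f : V -> R) : open U -> (forall z, U z -> f z != 0) ->
  Cn n U f -> Cn n U (fun w => (f w)^-1).
Proof.
move=> oU f0; elim: n f f0 => [|n IH] f f0.
  by move=> cf z Uz; apply: cvgV (f0 _ Uz) (cf _ Uz).
move=> Cf'; have [df Cf] := Cf'; split=> [z Uz|v].
  by have [] := deriv_atV (f0 _ Uz) (deriv_at_self 0 (df z Uz)).
have CV := IH _ f0 (CnW Cf').
apply: (Cn_ext (f := fun w => - ('D_v f w * ((f w)^-1 * (f w)^-1)))) => // [z Uz|].
  have [_ ->] := deriv_atV (f0 _ Uz) (deriv_at_self v (df z Uz)).
  by rewrite mulNr expr2 invfM.
by apply: CnN => //; apply: CnM (Cf v) _ => //; exact: CnM.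
Qed.

Lemma Cn_expR n U (f : V -> R) : open U -> Cn n U f ->
  Cn n U (fun w => expR (f w)).
Proof.
move=> oU; elim: n f => [|n IH] f.
  move=> cf z Uz; apply: (@continuous_comp _ _ _ f (@expR R)); first exact: cf.
  exact: continuous_expR.
move=> Cf'; have [df Cf] := Cf'; split=> [z Uz|v].
  by have [] := deriv_at_comp (deriv_at_self 0 (df z Uz)) (is_derive_expR _).
apply: (Cn_ext (f := fun w => expR (f w) * 'D_v f w)) => // [z Uz|].
  by have [_ ->] := deriv_at_comp (deriv_at_self v (df z Uz)) (is_derive_expR _).
by apply: CnM (IH _ (CnW Cf')) (Cf v).
Qed.

End Cn.

Section Smooth.
Context {R : realType} {V : normedModType R}.
Implicit Types (z v : V) (U : set V) (f g : V -> R).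

Lemma smooth_onD U f g : open U -> smooth_on U f -> smooth_on U g ->
  smooth_on U (fun w => f w + g w).
Proof. by move=> oU sf sg n; exact: CnD. Qed.

Lemma smooth_onM U f g : open U -> smooth_on U f -> smooth_on U g ->
  smooth_on U (fun w => f w * g w).
Proof. by move=> oU sf sg n; exact: CnM. Qed.

Lemma smooth_onN U f : open U -> smooth_on U f -> smooth_on U (fun w => - f w).
Proof. by move=> oU sf n; exact: CnN. Qed.

Lemma smooth_onV U f : open U -> (forall z, U z -> f z != 0) ->
  smooth_on U f -> smooth_on U (fun w => (f w)^-1).
Proof. by move=> oU f0 sf n; exact: CnV. Qed.

Lemma smooth_on_expR U f : open U -> smooth_on U f ->
  smooth_on U (fun w => expR (f w)).
Proof. by move=> oU sf n; exact: Cn_expR. Qed.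

Lemma smooth_on_cst U (c : R) : smooth_on U (fun=> c).
Proof. by move=> n; exact: Cn_cst. Qed.

Lemma smooth_on_lin U (h : {linear V -> R}) : continuous h -> smooth_on U h.
Proof. by move=> hc n; exact: Cn_lin. Qed.

Lemma smooth_on_ext U f g : open U -> (forall w, U w -> f w = g w) ->
  smooth_on U f -> smooth_on U g.
Proof. by move=> oU fg sf n; exact: Cn_ext (sf n). Qed.

Lemma smooth_on_derive (W : normedModType R) U (f : V -> W) v :
  smooth_on U f -> smooth_on U ('D_v f).
Proof. by move=> sf n; exact: (sf n.+1).2. Qed.

Lemma smooth_on_differentiable (W : normedModType R) U (f : V -> W) z :
  smooth_on U f -> U z -> differentiable f z.
Proof. by move=> sf Uz; exact: (sf 1%N).1. Qed.

Lemma smooth_on_deriv_at U f z v : smooth_on U f -> U z ->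
  deriv_at f z v ('D_v f z).
Proof. by move=> sf Uz; split=> //; exact: smooth_on_differentiable sf Uz. Qed.

End Smooth.

(** * Symmetry of second derivatives *)

Section Schwarz.
Context {R : realType} {V : normedModType R}.
Implicit Types (z v w p : V) (U : set V) (f : V -> R).

Lemma is_derive_line f p v t : differentiable f (p + t *: v) ->
  is_derive t 1 (fun t : R => f (p + t *: v)) ('D_v f (p + t *: v)).
Proof.
move=> df; set g := fun t : R => _.
have gE : (fun h : R => h^-1 *: (g (h *: (1 : R) + t) - g t)) =
    (fun h : R => h^-1 *: (f (h *: v + (p + t *: v)) - f (p + t *: v))).
  apply/funext => h; congr (_ *: (f _ - _)).
  by rewrite [h *: 1]mulr1 scalerDl addrCA.
have dg : derivable g t 1 by rewrite /derivable gE; exact: diff_derivable.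
by apply: DeriveDef => //; rewrite /derive gE.
Qed.

(** Mean value theorem twice: along v for the difference of f on two opposite sides of the
    parallelogram, then along w for ['D_v f]. *)
Lemma second_difference U f z v w (h : R) : 0 < h ->
  (forall s t, 0 <= s <= h -> 0 <= t <= h -> U (z + s *: v + t *: w)) ->
  (forall x, U x -> differentiable f x) ->
  (forall x, U x -> differentiable ('D_v f) x) ->
  exists s t, [/\ 0 <= s <= h, 0 <= t <= h &
    f (z + h *: v + h *: w) - f (z + h *: v) - (f (z + h *: w) - f z) =
    h ^+ 2 * 'D_w ('D_v f) (z + s *: v + t *: w)].
Proof.
move=> h0 hU df ddf.
have hh : 0 <= h <= h by rewrite lexx ltW.
have h00 : 0 <= (0 : R) <= h by rewrite lexx ltW.
pose g := fun s : R => f (z + h *: w + s *: v) - f (z + s *: v).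
have Ds s : 0 <= s <= h ->
    is_derive s 1 g ('D_v f (z + h *: w + s *: v) - 'D_v f (z + s *: v)).
  move=> hs; apply: is_deriveB; apply: is_derive_line; apply: df.
    by rewrite addrAC; exact: hU.
  by have := hU s 0 hs h00; rewrite scale0r addr0.
have in_ab x : x \in `]0, h[%R -> 0 <= x <= h.
  by rewrite in_itv /= => /andP[a b]; rewrite !ltW.
have [|s /in_ab hs] := MVT h0 (fun x hx => Ds x (in_ab x hx)).
  apply: derivable_within_continuous => x; rewrite in_itv /= => hx.
  by have [] := Ds x hx.
rewrite /g scale0r !addr0 subr0 (addrAC z) => ->.
have Dt t : 0 <= t <= h -> is_derive t 1 (fun t : R => 'D_v f (z + s *: v + t *: w))
    ('D_w ('D_v f) (z + s *: v + t *: w)).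
  by move=> ht; apply: is_derive_line; apply: ddf; exact: hU.
have [|t /in_ab ht] := MVT h0 (fun x hx => Dt x (in_ab x hx)).
  apply: derivable_within_continuous => x; rewrite in_itv /= => hx.
  by have [] := Dt x hx.
rewrite scale0r !addr0 subr0 addrAC => ->.
exists s, t; split=> //; ring.
Qed.

(** The second difference is symmetric in v and w, so both mixed derivatives take a common value at
    two points of a small parallelogram. By continuity each is within half the supposed gap of its
    value at z, a contradiction. *)
Lemma derive_comm U f z v w : open U -> Cn 2 U f -> U z ->
  'D_w ('D_v f) z = 'D_v ('D_w f) z.
Proof.
move=> oU [df Cf] Uz; apply/eqP; apply: contraT => ab.
set a := 'D_w _ z in ab *; set b := 'D_v ('D_w f) z in ab *.
pose e := `|a - b| / 2.
have e0 : 0 < e by rewrite divr_gt0// normr_gt0 subr_eq0.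
have ca : {for z, continuous ('D_w ('D_v f))} := ((Cf v).2 w) z Uz.
have cb : {for z, continuous ('D_v ('D_w f))} := ((Cf w).2 v) z Uz.
have na : \forall x \near z, `|a - 'D_w ('D_v f) x| < e.
  by move/cvgrPdist_lt: ca; apply.
have nb : \forall x \near z, `|b - 'D_v ('D_w f) x| < e.
  by move/cvgrPdist_lt: cb; apply.
have nU : \forall x \near z, U x by apply: open_nbhs_nbhs.
have [r /= r0 hr] := (nbhs_ballP _ _).1 (filterI (filterI na nb) nU).
(* The summand 1 keeps d positive when v = w = 0; with h = r / (2 d) the parallelogram of sides h v
   and h w lies in the ball of radius r. *)
pose d := `|v| + `|w| + 1.
have d0 : 0 < d by rewrite ltr_wpDl// addr_ge0.
pose h := r / (2 * d).
have h0 : 0 < h by rewrite divr_gt0// mulr_gt0.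
have hball s t : 0 <= s <= h -> 0 <= t <= h -> ball z r (z + s *: v + t *: w).
  move=> /andP[s0 sh] /andP[t0 th]; rewrite -ball_normE /= -addrA opprD addNKr normrN.
  apply: (le_lt_trans (ler_normD _ _)); rewrite !normrZ !ger0_norm//.
  apply: (@le_lt_trans _ _ (h * `|v| + h * `|w|)); first by rewrite lerD// ler_wpM2r.
  rewrite -mulrDr; apply: (@lt_le_trans _ _ (h * d)).
    by rewrite ltr_pM2l// ltrDl.
  have -> : h * d = r / 2 by rewrite /h; field; rewrite gt_eqF.
  lra.
have [s [t [hs ht E1]]] := @second_difference U f z v w h h0
  (fun s t hs ht => (hr _ (hball s t hs ht)).2) df (Cf v).1.
have [|t' [s' [ht' hs' E2]]] := @second_difference U f z w v h h0 _ df (Cf w).1.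
  by move=> t' s' ht' hs'; rewrite addrAC; exact: (hr _ (hball s' t' hs' ht')).2.
have h2 : h ^+ 2 != 0 by rewrite expf_neq0// gt_eqF.
have E : 'D_w ('D_v f) (z + s *: v + t *: w) = 'D_v ('D_w f) (z + s' *: v + t' *: w).
  rewrite (addrAC z (h *: w) (h *: v)) (addrAC z (t' *: w) (s' *: v)) in E2.
  apply: (mulfI h2); rewrite -[LHS]E1 -[RHS]E2.
  move: (f (z + h *: v + h *: w)) (f (z + h *: v)) (f (z + h *: w)) (f z) => p q r' t0.
  by ring.
have A := (hr _ (hball s t hs ht)).1.1.
have B := (hr _ (hball s' t' hs' ht')).1.2.
rewrite /= E in A; rewrite /= distrC in B.
have := le_lt_trans (ler_distD _ _ _) (ltrD A B).
by rewrite -splitr ltxx.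
Qed.

End Schwarz.

(** * Chain rule, coordinates on the tangent plane and Euler's theorem *)

Lemma sum_ord2 (V : nmodType) (f : 'I_2 -> V) : \sum_i f i = f 0 + f 1.
Proof.
by rewrite !big_ord_recl big_ord0 addr0; congr (_ + f _); exact: val_inj.
Qed.

Lemma row2E (R : pzRingType) (u : 'rV[R]_2) :
  u = u 0 0 *: delta_mx 0 0 + u 0 1 *: delta_mx 0 1.
Proof. by rewrite [LHS]row_sum_delta sum_ord2. Qed.

Section Chain.
Context {R : realType}.

Lemma deriv_at_chain (V W : normedModType R) (psi : V -> W) (f : W -> R) z v u :
  differentiable psi z -> 'D_v psi z = u -> differentiable f (psi z) ->
  deriv_at (fun w => f (psi w)) z v ('D_u f (psi z)).
Proof.
move=> dpsi <- df; split; first exact: (differentiable_comp dpsi df).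
rewrite deriveE; last exact: (differentiable_comp dpsi df).
by rewrite [LHS](congr1 (fun F => F v) (diff_comp dpsi df)) /= !deriveE.
Qed.

Lemma differentiable_fst (V W : normedModType R) (z : V * W) :
  differentiable (fun w : V * W => w.1) z.
Proof. apply: (@linear_differentiable _ _ _ fst) => w; exact: cvg_fst. Qed.

Lemma differentiable_snd (V W : normedModType R) (z : V * W) :
  differentiable (fun w : V * W => w.2) z.
Proof. apply: (@linear_differentiable _ _ _ snd) => w; exact: cvg_snd. Qed.

Lemma derive_fst (V W : normedModType R) (z v : V * W) :
  'D_v (fun w : V * W => w.1) z = v.1.
Proof.
rewrite deriveE; last exact: differentiable_fst.
by rewrite (@diff_lin _ _ _ fst)// => w; exact: cvg_fst.
Qed.

Lemma derive_snd (V W : normedModType R) (z v : V * W) :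
  'D_v (fun w : V * W => w.2) z = v.2.
Proof.
rewrite deriveE; last exact: differentiable_snd.
by rewrite (@diff_lin _ _ _ snd)// => w; exact: cvg_snd.
Qed.

Lemma derive_pair (V W1 W2 : normedModType R) (f : V -> W1) (g : V -> W2) z v :
  differentiable f z -> differentiable g z ->
  'D_v (fun w => (f w, g w)) z = ('D_v f z, 'D_v g z).
Proof.
move=> df dg; rewrite deriveE; last exact: differentiable_pair.
by rewrite diff_pair// !deriveE.
Qed.
End Chain.

Section TangentPlane.
Context {R : realType}.
Local Notation TU := ('rV[R]_2 * 'rV[R]_2)%type.
Implicit Types (f : TU -> R) (z v : TU) (U : set TU) (i j : 'I_2).

Lemma derive_dxdy f z v : differentiable f z ->
  'D_v f z = v.1 0 0 * dx 0 f z + v.1 0 1 * dx 1 f z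
    + (v.2 0 0 * dy 0 f z + v.2 0 1 * dy 1 f z).
Proof.
move=> df; rewrite /dx /dy !deriveE//.
have -> : v = v.1 0 0 *: (delta_mx 0 0, 0) + v.1 0 1 *: (delta_mx 0 1, 0)
    + (v.2 0 0 *: (0, delta_mx 0 0) + v.2 0 1 *: (0, delta_mx 0 1)).
  case: v => a b /=; rewrite {1}(row2E a) {1}(row2E b).
  by congr pair; rewrite /= !scaler0 ?addr0 ?add0r.
rewrite !linearD !linearZ /=.
by rewrite !mxE /= !(mulr0, mulr1, addr0, add0r).
Qed.

Lemma smooth_dx U f i : smooth_on U f -> smooth_on U (dx i f).
Proof. exact: smooth_on_derive. Qed.

Lemma smooth_dy U f i : smooth_on U f -> smooth_on U (dy i f).
Proof. exact: smooth_on_derive. Qed.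

Lemma dy_dx U f i j z : open U -> smooth_on U f -> U z ->
  dy i (dx j f) z = dx j (dy i f) z.
Proof. by move=> oU sf Uz; exact: derive_comm (sf 2%N) Uz. Qed.

Lemma dy_dy U f i j z : open U -> smooth_on U f -> U z ->
  dy i (dy j f) z = dy j (dy i f) z.
Proof. by move=> oU sf Uz; exact: derive_comm (sf 2%N) Uz. Qed.

Fact fiber_coord_is_linear i : linear (fun z : TU => z.2 0 i : R).
Proof. by move=> a u v; rewrite !mxE. Qed.

Definition fiber_coord i : {linear TU -> R} :=
  HB.pack (fun z : TU => z.2 0 i : R)
    (GRing.isLinear.Build R TU R _ _ (fiber_coord_is_linear i)).

Lemma fiber_coord_continuous i : continuous (fiber_coord i).
Proof.
by move=> z; apply: continuous_comp (@coord_continuous _ _ _ 0 i _); exact: cvg_snd.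
Qed.

Lemma smooth_y U i : smooth_on U (fun z => z.2 0 i).
Proof. exact: (smooth_on_lin U (@fiber_coord_continuous i)). Qed.

Lemma deriv_at_y z v i : deriv_at (fun w : TU => w.2 0 i) z v (v.2 0 i).
Proof. exact: (deriv_at_lin z v (@fiber_coord_continuous i)). Qed.

Definition fiber_scale (k : R) z : TU := (z.1, k *: z.2).

Lemma differentiable_fiber_scale k z : differentiable (fiber_scale k) z.
Proof.
apply: differentiable_pair; first exact: differentiable_fst.
exact: (differentiableZ _ (differentiable_snd _)).
Qed.

Lemma derive_fiber_scale k z v : 'D_v (fiber_scale k) z = fiber_scale k v.
Proof.
have ds := @differentiable_snd R _ _ z.
rewrite derive_pair; [|exact: differentiable_fst|exact: (differentiableZ _ ds)].
by rewrite derive_fst [X in (_, X)]deriveZ ?derive_snd//; exact: diff_derivable.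
Qed.

(** Differentiate f o [fiber_scale k] = c f. The direction is scaled along with the point, which is
    why base derivatives keep the degree of f ([hom_dx]) and fibre derivatives lower it by one
    ([hom_dy]). *)
Lemma derive_homogeneous U f (k c : R) z v : open U -> U z ->
  (forall w, U w -> f (fiber_scale k w) = c * f w) ->
  differentiable f z -> differentiable f (fiber_scale k z) ->
  'D_(fiber_scale k v) f (fiber_scale k z) = c * 'D_v f z.
Proof.
move=> oU Uz fk df dfk.
have [_ <-] := deriv_at_chain (differentiable_fiber_scale k z)
  (derive_fiber_scale k z v) dfk.
have [_ <-] : deriv_at (fun w => c * f w) z v (c * 'D_v f z).
  apply: deriv_at_eq; first exact: (deriv_atM (deriv_at_cst _ _ _) (deriv_at_self _ df)).
  by rewrite mul0r add0r.
by apply: near_eq_derive; exact: near_eq_on fk.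
Qed.

(** The homogeneity factor is an arbitrary function c differentiable at 1, so that the negative
    degree of the fibre derivatives of phi is covered along with the powers k ^+ n. *)
Lemma euler f z (c : R -> R) (c' : R) : differentiable f z ->
  (forall k, 0 < k -> f (fiber_scale k z) = c k * f z) ->
  is_derive (1 : R) (1 : R) c c' ->
  z.2 0 0 * dy 0 f z + z.2 0 1 * dy 1 f z = c' * f z.
Proof.
move=> df fk dc.
have <- : 'D_(0, z.2) f z = z.2 0 0 * dy 0 f z + z.2 0 1 * dy 1 f z.
  rewrite (derive_dxdy _ df).
  have z0 i : (0 : 'rV[R]_2) 0 i = 0 by rewrite mxE.
  by move: (dx 0 f z) (dx 1 f z) => a b; rewrite !z0 !mul0r !add0r.
(* The ray through z is an affine line starting at the zero vector, so [is_derive_line]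
   differentiates f along it at t = 1. *)
have zE (t : R) : (z.1, 0) + t *: (0, z.2) = fiber_scale t z :> TU.
  by rewrite /fiber_scale; congr pair; rewrite /= ?scaler0 ?addr0 ?add0r.
have z1 : fiber_scale 1 z = z by rewrite /fiber_scale scale1r; case: z {df fk zE}.
have dl : differentiable f ((z.1, 0) + (1:R) *: (0, z.2)) by rewrite zE z1.
have [_ E1] := is_derive_line dl; rewrite zE z1 in E1; rewrite -E1.
have dck : deriv_at (fun k => c k * f z) (1:R) (1:R) (c' * f z).
  apply: deriv_at_eq (deriv_atM (a := c') (b := 0) _ (deriv_at_cst _ _ _)) _.
    split; last exact: derive_val.
    by apply/derivable1_diffP; exact: (@ex_derive _ _ _ _ _ _ _ dc).
  by rewrite mulr0 addr0.
rewrite -dck.2; apply: near_eq_derive; near=> k; rewrite zE fk//.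
by near: k; apply: lt_nbhsr; exact: ltr01.
Unshelve. all: by end_near. Qed.

End TangentPlane.

(** * The geodesic spray *)

Lemma ord2P (i : 'I_2) : {i = 0} + {i = 1}.
Proof. by case: i => -[|[|//]] hi; [left|right]; exact: val_inj. Qed.

Lemma det_mx2 (R : comPzRingType) (A : 'M[R]_2) :
  \det A = A 0 0 * A 1 1 - A 0 1 * A 1 0.
Proof.
rewrite (expand_det_row _ 0) sum_ord2 /cofactor !det_mx11 !mxE /=.
rewrite !expr0 expr1 mul1r mulN1r mulrN.
by congr (_ * A _ _ - _ * A _ _); exact: val_inj.
Qed.

Lemma cramer2 (R : fieldType) (a b c d u v x y : R) : a * d - b * c != 0 ->
  a * x + b * y = u -> c * x + d * y = v ->
  x = (d * u - b * v) / (a * d - b * c) /\ y = (a * v - c * u) / (a * d - b * c).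
Proof. by move=> D <- <-; split; field. Qed.

(** This is the covector 4 g_ij G^j; the fibre Hessian of F^2 being 2 g_ij, the factor 2 in
    [spray_coefP] results. *)
Definition spray_rhs (R : realType) (f : 'rV[R]_2 * 'rV[R]_2 -> R) (i : 'I_2)
    (z : 'rV[R]_2 * 'rV[R]_2) : R :=
  z.2 0 0 * dy i (dx 0 (sqF f)) z + z.2 0 1 * dy i (dx 1 (sqF f)) z
  - dx i (sqF f) z.

(* [ring] and [field] compare their atoms up to conversion, which blows up on
   iterated derivatives, so these are generalized first. *)
Ltac gen_atoms := repeat match goal with
  | |- context [dy ?i ?f ?z] => generalize (dy i f z); intro
  | |- context [dx ?i ?f ?z] => generalize (dx i f z); intro
  | |- context [spray_rhs ?f ?i ?z] => generalize (spray_rhs f i z); intro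
  | |- context [spray_coef ?f ?i ?z] => generalize (spray_coef f i z); intro
  end.

Section SprayEquation.
Context {R : realType}.
Local Notation TU := ('rV[R]_2 * 'rV[R]_2)%type.
Implicit Types (f F h : TU -> R) (z v : TU) (U : set TU) (i j : 'I_2).

Lemma metricE f z i j : metric f z i j = 2^-1 * dy i (dy j (sqF f)) z.
Proof. by rewrite mxE. Qed.

(** Lowering the index replaces the definition through the inverse metric by a linear system for the
    spray coefficients, the form in which they are handled from here on. *)
Lemma spray_coefP f z i : \det (metric f z) != 0 ->
  2 * (dy i (dy 0 (sqF f)) z * spray_coef f 0 z
       + dy i (dy 1 (sqF f)) z * spray_coef f 1 z) = spray_rhs f i z.
Proof.
move=> D; pose b := \col_i spray_rhs f i z.
have gu : metric f z \in unitmx by rewrite unitmxE unitfE.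
have GE j : spray_coef f j z = 4^-1 * (invmx (metric f z) *m b) j 0.
  rewrite /spray_coef /inv_metric; congr (_ * _); rewrite [RHS]mxE.
  by apply: eq_bigr => l _; congr (_ * _); rewrite [RHS]mxE sum_ord2.
have := congr1 (fun A : 'cV_2 => A i 0) (mulKVmx gu b).
rewrite /= mxE [RHS]mxE sum_ord2 !metricE => <-; rewrite !GE.
by move: (_ *m _) => X; gen_atoms; field.
Qed.

(** Cramer's rule. Spray coefficients are identified by checking the linear system: for homogeneity,
    for (ii) -> (iii) and for changes of coordinates. *)
Lemma spray_coef_unique f z (g : 'I_2 -> R) : \det (metric f z) != 0 ->
  (forall i, 2 * (dy i (dy 0 (sqF f)) z * g 0 + dy i (dy 1 (sqF f)) z * g 1)
             = spray_rhs f i z) ->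
  forall i, spray_coef f i z = g i.
Proof.
move=> D gE.
have D' : dy 0 (dy 0 (sqF f)) z * dy 1 (dy 1 (sqF f)) z
    - dy 0 (dy 1 (sqF f)) z * dy 1 (dy 0 (sqF f)) z != 0.
  move: D; rewrite det_mx2 !metricE; apply: contra_neq => D.
  by rewrite -[RHS](mulr0 (4^-1 : R)) -D; gen_atoms; field.
have half (x y : R) : 2 * x = y -> x = y / 2 by move=> <-; field.
have [a0 a1] := cramer2 D' (half _ _ (spray_coefP 0 D)) (half _ _ (spray_coefP 1 D)).
have [b0 b1] := cramer2 D' (half _ _ (gE 0)) (half _ _ (gE 1)).
move=> i; case: (ord2P i) => ->.
  rewrite b0.
  exact: a0.
rewrite b1.
exact: a1.
Qed.

Lemma deriv_at_dy_y z i j :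
  deriv_at (fun w : TU => w.2 0 i) z (0, delta_mx 0 j) (i == j)%:R.
Proof. by apply: deriv_at_eq (deriv_at_y _ _ _) _; rewrite mxE eqxx. Qed.

Lemma deriv_at_dx_y z i j :
  deriv_at (fun w : TU => w.2 0 i) z (delta_mx 0 j, 0) 0.
Proof. by apply: deriv_at_eq (deriv_at_y _ _ _) _; rewrite mxE. Qed.

Lemma smooth_deriv_at_dy U f z i : smooth_on U f -> U z ->
  deriv_at f z (0, delta_mx 0 i) (dy i f z).
Proof. exact: smooth_on_deriv_at. Qed.

Lemma smooth_deriv_at_dx U f z i : smooth_on U f -> U z ->
  deriv_at f z (delta_mx 0 i, 0) (dx i f z).
Proof. exact: smooth_on_deriv_at. Qed.

End SprayEquation.

Ltac smooth_tac := repeat match goal with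
  | |- smooth_on _ (fun w => @?f w + @?g w) => apply: smooth_onD => //
  | |- smooth_on _ (fun w => - @?f w) => apply: smooth_onN => //
  | |- smooth_on _ (fun w => @?f w * @?g w) => apply: smooth_onM => //
  | |- smooth_on _ (fun w => @fun_of_matrix _ _ _ _ ?a ?b) => exact: smooth_y
  | |- smooth_on _ (fun w => ?c) => exact: smooth_on_cst
  | |- smooth_on _ (dy _ _) => apply: smooth_dy => //
  | |- smooth_on _ (fun w => dy _ _ w) => apply: smooth_dy => //
  | |- smooth_on _ (dx _ _) => apply: smooth_dx => //
  | |- smooth_on _ (fun w => dx _ _ w) => apply: smooth_dx => //
  | H : _ |- smooth_on _ _ => solve [exact: H]
  end.

(** The value of the derivative is left as an existential variable and built by the product rule.
    Powers are not decomposed, which is why functions to be differentiated are written with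
    products. *)
Ltac deriv_tac := repeat match goal with
  | |- deriv_at (fun w => @?f w + @?g w) _ _ _ => eapply deriv_atD
  | |- deriv_at (fun w => - @?f w) _ _ _ => eapply deriv_atN
  | |- deriv_at (fun w => @?f w * @?g w) _ _ _ => eapply deriv_atM
  | |- deriv_at (fun w => (@?f w)^-1) _ _ _ => eapply deriv_atV
  | |- deriv_at (fun w => @fun_of_matrix _ _ _ _ ?a ?b) _ (0, delta_mx _ _) _ => eapply deriv_at_dy_y
  | |- deriv_at (fun w => @fun_of_matrix _ _ _ _ ?a ?b) _ (delta_mx _ _, 0) _ => eapply deriv_at_dx_y
  | |- deriv_at (fun w => ?c) _ _ _ => eapply deriv_at_cst
  | |- deriv_at _ _ (0, delta_mx _ _) _ => 
      eapply smooth_deriv_at_dy; [smooth_tac|eassumption]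
  | |- deriv_at _ _ (delta_mx _ _, 0) _ => 
      eapply smooth_deriv_at_dx; [smooth_tac|eassumption]
  | |- deriv_at _ _ _ _ => 
      eapply smooth_on_deriv_at; [smooth_tac|eassumption]
  end.

(** The local hypotheses in one coordinate domain, detached from the surface, so that they can be
    instantiated by the chart expression of F and also by that of Fbar ([conformal_finsler]). *)
Record finsler_on (R : realType) (U : set ('rV[R]_2 * 'rV[R]_2))
    (F : 'rV[R]_2 * 'rV[R]_2 -> R) : Prop := FinslerOn {
  finsler_open : open U;
  finsler_cone : forall k z, 0 < k -> U z -> U (fiber_scale k z);
  finsler_smooth : smooth_on U F;
  finsler_neq0 : forall z, U z -> F z != 0;
  finsler_hom : forall k z, 0 < k -> U z -> F (fiber_scale k z) = k * F z;
  finsler_det : forall z, U z -> \det (metric F z) != 0 }.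

Section FinslerOn.
Context {R : realType}.
Local Notation TU := ('rV[R]_2 * 'rV[R]_2)%type.
Context {U : set TU} {F : TU -> R} (FF : finsler_on U F).
Let oU := finsler_open FF.
Let U_cone := finsler_cone FF.
Let F_smooth := finsler_smooth FF.
Let F_hom := finsler_hom FF.
Let det_neq0 := finsler_det FF.
Implicit Types (f h : TU -> R) (z v : TU) (i j : 'I_2) (k c : R).
Local Notation L := (sqF F).
Local Notation G := (spray_coef F).

Lemma hom_dx f k c i : 0 < k -> smooth_on U f ->
  (forall w, U w -> f (fiber_scale k w) = c * f w) ->
  forall w, U w -> dx i f (fiber_scale k w) = c * dx i f w.
Proof.
move=> k0 sf fk w Uw.
have df := smooth_on_differentiable sf Uw.
have dfk := smooth_on_differentiable sf (U_cone k0 Uw).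
have := derive_homogeneous (delta_mx 0 i, 0) oU Uw fk df dfk.
by rewrite /fiber_scale /= scaler0.
Qed.

Lemma hom_dy f k c i : 0 < k -> smooth_on U f ->
  (forall w, U w -> f (fiber_scale k w) = c * f w) ->
  forall w, U w -> dy i f (fiber_scale k w) = c / k * dy i f w.
Proof.
move=> k0 sf fk w Uw.
have df := smooth_on_differentiable sf Uw.
have dfk := smooth_on_differentiable sf (U_cone k0 Uw).
have := derive_homogeneous (0, delta_mx 0 i) oU Uw fk df dfk.
rewrite mulrAC => <-; rewrite /dy !deriveE//.
have -> : fiber_scale k (0, delta_mx 0 i) = k *: (0, delta_mx 0 i).
  by rewrite /fiber_scale; congr pair; rewrite /= scaler0.
by rewrite linearZ /= mulrC mulKf ?gt_eqF.
Qed.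

#[local] Opaque dx dy spray_coef.

Lemma sqF_smooth : smooth_on U L.
Proof.
by apply: (smooth_on_ext (f := fun z => F z * F z)) => //; exact: smooth_onM.
Qed.
Let sL := sqF_smooth.

Lemma sqF_hom k : 0 < k -> forall z, U z -> L (fiber_scale k z) = k ^+ 2 * L z.
Proof. by move=> k0 z Uz; rewrite /sqF F_hom// exprMn. Qed.

(** Smoothness of G is read off from this quotient, whose denominator vanishes nowhere on U. *)
Lemma spray_coefE z : U z ->
  let D := dy 0 (dy 0 L) z * dy 1 (dy 1 L) z - dy 0 (dy 1 L) z * dy 1 (dy 0 L) z in
  [/\ D != 0,
    G 0 z = 2^-1 * (dy 1 (dy 1 L) z * spray_rhs F 0 z - dy 0 (dy 1 L) z * spray_rhs F 1 z) / D &
    G 1 z = 2^-1 * (dy 0 (dy 0 L) z * spray_rhs F 1 z - dy 1 (dy 0 L) z * spray_rhs F 0 z) / D].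
Proof.
move=> Uz D.
have D0 : D != 0.
  have := det_neq0 Uz; rewrite det_mx2 !metricE; apply: contra_neq => DE.
  by rewrite -[RHS](mulr0 (4^-1 : R)) -DE /D; gen_atoms; field.
have half (x y : R) : 2 * x = y -> x = 2^-1 * y by move=> <-; field.
have [-> ->] := cramer2 D0 (half _ _ (spray_coefP 0 (det_neq0 Uz)))
  (half _ _ (spray_coefP 1 (det_neq0 Uz))).
move: D0; rewrite /D.
gen_atoms; move=> D0.
by split=> //; field.
Qed.

Lemma spray_coef_smooth i : smooth_on U (G i).
Proof.
pose D z := dy 0 (dy 0 L) z * dy 1 (dy 1 L) z - dy 0 (dy 1 L) z * dy 1 (dy 0 L) z.
have D0 z : U z -> D z != 0 by move=> /spray_coefE[].
have sD : smooth_on U (fun z => (D z)^-1).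
  by apply: smooth_onV => //; rewrite /D; smooth_tac.
have sb j : smooth_on U (spray_rhs F j) by rewrite /spray_rhs; smooth_tac.
case: (ord2P i) => ->.
- apply: (smooth_on_ext (f := fun z => 2^-1 * (dy 1 (dy 1 L) z * spray_rhs F 0 z
    - dy 0 (dy 1 L) z * spray_rhs F 1 z) * (D z)^-1)) => //.
    by move=> w /spray_coefE[_ -> _].
  by smooth_tac.
- apply: (smooth_on_ext (f := fun z => 2^-1 * (dy 0 (dy 0 L) z * spray_rhs F 1 z
    - dy 1 (dy 0 L) z * spray_rhs F 0 z) * (D z)^-1)) => //.
    by move=> w /spray_coefE[_ _ ->].
  by smooth_tac.
Qed.
Let sG := spray_coef_smooth.

(** At the scaled point the Hessian of L is unchanged and the right-hand side of the system is
    multiplied by k^2, so k^2 G solves it there. *)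
Lemma spray_coef_hom k i : 0 < k ->
  forall z, U z -> G i (fiber_scale k z) = k ^+ 2 * G i z.
Proof.
move=> k0 z Uz; have k0' : k != 0 by rewrite gt_eqF.
have hL := sqF_hom k0.
have h1 j := hom_dy j k0 sL hL.
have h2 j := hom_dx j k0 sL hL.
have h3 j l := hom_dy j k0 (smooth_dy l sL) (h1 l).
have h4 j l := hom_dy j k0 (smooth_dx l sL) (h2 l).
apply: (spray_coef_unique (g := fun i => k ^+ 2 * G i z)); first exact: det_neq0 (U_cone k0 Uz).
move=> j.
have yE l : (fiber_scale k z).2 0 l = k * z.2 0 l by rewrite mxE.
move: (spray_coefP j (det_neq0 Uz)) (h3 j 0 z Uz) (h3 j 1 z Uz) (h4 j 0 z Uz)
  (h4 j 1 z Uz) (h2 j z Uz) (yE 0) (yE 1).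
rewrite /spray_rhs; gen_atoms.
have -> : k ^+ 2 / k / k = 1 by field.
have -> : k ^+ 2 / k = k by field.
rewrite !mul1r => E -> -> -> -> -> -> ->.
rewrite !(mulrCA _ (k ^+ 2)) -mulrDr mulrCA E; ring.
Qed.

End FinslerOn.

Section Spray.
Context {R : realType}.
Local Notation TU := ('rV[R]_2 * 'rV[R]_2)%type.
Context {U : set TU} {F : TU -> R} (FF : finsler_on U F).
Implicit Types (f h : TU -> R) (z v : TU) (i j : 'I_2) (k c : R).
Local Notation L := (sqF F).
Local Notation G := (spray_coef F).
Let oU := finsler_open FF.
Let sF := finsler_smooth FF.
Let sL := sqF_smooth FF.
Let sG i := spray_coef_smooth FF i.

(** The derivative S h along the geodesic spray of F, that is F h_{,1} ([comma1E]). *)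
Definition spray_deriv h z : R :=
  z.2 0 0 * dx 0 h z + z.2 0 1 * dx 1 h z
  - 2 * (G 0 z * dy 0 h z + G 1 z * dy 1 h z).

Lemma deltaE h i z : delta F i h z =
  dx i h z - (dy i (G 0) z * dy 0 h z + dy i (G 1) z * dy 1 h z).
Proof. by rewrite /delta sum_ord2. Qed.

#[local] Opaque dx dy spray_coef.

Lemma spray_deriv_smooth h : smooth_on U h -> smooth_on U (spray_deriv h).
Proof.
move=> sh; have := sG 0; have := sG 1; rewrite /spray_deriv => s1 s0; smooth_tac.
Qed.

(** Differentiating the coefficients y^k and G^j of S gives d_i h - 2 G^j_i d.j h, which is 2
    delta_i h - d_i h. Without the summand 2 delta_i h the right-hand side is the Euler-Lagrange
    expression of h. *)
Lemma dy_spray_deriv h i z : smooth_on U h -> U z ->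
  dy i (spray_deriv h) z =
  z.2 0 0 * dy i (dx 0 h) z + z.2 0 1 * dy i (dx 1 h) z - dx i h z
  - 2 * (G 0 z * dy i (dy 0 h) z + G 1 z * dy i (dy 1 h) z) + 2 * delta F i h z.
Proof.
move=> sh Uz; have s0 := sG 0; have s1 := sG 1.
have [_ D] : deriv_at (spray_deriv h) z (0, delta_mx 0 i) (
    z.2 0 0 * dy i (dx 0 h) z + z.2 0 1 * dy i (dx 1 h) z - dx i h z
    - 2 * (G 0 z * dy i (dy 0 h) z + G 1 z * dy i (dy 1 h) z) + 2 * delta F i h z).
  apply: deriv_at_eq; first by rewrite /spray_deriv; deriv_tac.
  rewrite deltaE; case: (ord2P i) => ->; rewrite ?eqxx /=; gen_atoms; ring.
exact: D.
Qed.

Lemma euler_nat f z (n : nat) : smooth_on U f -> U z ->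
  (forall k, 0 < k -> f (fiber_scale k z) = k ^+ n * f z) ->
  z.2 0 0 * dy 0 f z + z.2 0 1 * dy 1 f z = n%:R * f z.
Proof.
move=> sf Uz fk; apply: (euler (c := fun k => k ^+ n)) => //.
  exact: smooth_on_differentiable sf Uz.
apply: DeriveDef; first exact: exprn_derivable.
by rewrite exp_derive expr1n /GRing.scale /= !mulr1.
Qed.

Lemma spray_coef_euler i z : U z ->
  z.2 0 0 * dy 0 (G i) z + z.2 0 1 * dy 1 (G i) z = 2 * G i z.
Proof.
move=> Uz; apply: euler_nat => // k k0; exact: spray_coef_hom FF _ _ k0 _ Uz.
Qed.

(** Euler's theorem for G gives y^i G^j_i = 2 G^j, the coefficient with which G^j enters S. *)
Lemma sum_delta h z : U z ->
  z.2 0 0 * delta F 0 h z + z.2 0 1 * delta F 1 h z = spray_deriv h z.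
Proof.
move=> Uz; rewrite !deltaE /spray_deriv.
move: (congr1 (fun t => t * dy 0 h z) (spray_coef_euler 0 Uz)).
move: (congr1 (fun t => t * dy 1 h z) (spray_coef_euler 1 Uz)) => /=; gen_atoms.
by move=> E0 E1; lra.
Qed.

Lemma comma1E h z : U z -> comma1 F h z = spray_deriv h z / F z.
Proof.
move=> Uz; rewrite -sum_delta// /comma1 sum_ord2 /ell_up.
move: (delta F 0 h z) (delta F 1 h z) (F z)^-1 => d0 d1 f; ring.
Qed.

Lemma spray_deriv_hom (n : nat) h k z : 0 < k -> smooth_on U h -> U z ->
  (forall w, U w -> h (fiber_scale k w) = k ^+ n * h w) ->
  spray_deriv h (fiber_scale k z) = k ^+ n.+1 * spray_deriv h z.
Proof.
move=> k0 sh Uz hk; have k0' : k != 0 by rewrite gt_eqF.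
have yE l : (fiber_scale k z).2 0 l = k * z.2 0 l by rewrite mxE.
move: (hom_dx FF 0 k0 sh hk Uz) (hom_dx FF 1 k0 sh hk Uz) (hom_dy FF 0 k0 sh hk Uz)
  (hom_dy FF 1 k0 sh hk Uz) (yE 0) (yE 1) (spray_coef_hom FF 0 k0 Uz)
  (spray_coef_hom FF 1 k0 Uz).
rewrite /spray_deriv; gen_atoms => -> -> -> -> -> -> -> ->.
rewrite (exprS k n); move: (k ^+ n) => c; field; exact: k0'.
Qed.

(* The Euler-Lagrange expression of L vanishes along the spray, so [d.i (S L)]
   equals [2 delta_i L]; contracting with y gives [3 S L = 2 S L]. *)
Lemma spray_deriv_sqF z : U z -> spray_deriv L z = 0.
Proof.
move=> Uz.
have E : z.2 0 0 * dy 0 (spray_deriv L) z + z.2 0 1 * dy 1 (spray_deriv L) z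
    = 3 * spray_deriv L z.
  apply: euler_nat => //; first exact: spray_deriv_smooth.
  move=> k k0; apply: spray_deriv_hom => // w Uw; exact: sqF_hom FF _ k0 _ Uw.
move: E; rewrite !dy_spray_deriv// -sum_delta//.
move: (spray_coefP 0 (finsler_det FF Uz)) (spray_coefP 1 (finsler_det FF Uz)).
rewrite /spray_rhs; move: (delta F 0 L z) (delta F 1 L z) => d0 d1.
gen_atoms => <- <-; move=> E; lra.
Qed.

(** S L vanishes on the whole open set U, hence so does d.i (S L), which equals 2 delta_i L by the
    Euler-Lagrange equation. *)
Lemma delta_sqF i z : U z -> delta F i L z = 0.
Proof.
move=> Uz; have D : dy i (spray_deriv L) z = 0.
  have [_ D] : deriv_at (spray_deriv L) z (0, delta_mx 0 i) 0.
    apply: (@deriv_at_on _ _ U (fun=> 0)) => //; last exact: deriv_at_cst.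
    by move=> w Uw; rewrite spray_deriv_sqF.
  exact: D.
move: D; rewrite dy_spray_deriv//.
move: (spray_coefP i (finsler_det FF Uz)).
rewrite /spray_rhs; move: (delta F i L z) => d.
gen_atoms => <- E; lra.
Qed.

End Spray.

Arguments spray_deriv {R} F h z.

(** * The modified Berwald frame *)

Section Frame.
Context {R : realType}.
Local Notation TU := ('rV[R]_2 * 'rV[R]_2)%type.
Context {U : set TU} {F : TU -> R} (FF : finsler_on U F).
Implicit Types (f h : TU -> R) (z v : TU) (i j : 'I_2) (k c : R).
Local Notation L := (sqF F).
Let oU := finsler_open FF.
Let sF := finsler_smooth FF.
Let sL := sqF_smooth FF.

Definition vol z : R := Num.sqrt (signature F z * \det (metric F z)).

(** The component of the wedge product of the fibre differentials of F and h, in this order; it is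
    h_{;2} up to the factor F / vol ([semi2E]). *)
Definition wedge h z : R := dy 1 h z * dy 0 F z - dy 0 h z * dy 1 F z.

Lemma signature_det z : signature F z * \det (metric F z) = `|\det (metric F z)|.
Proof. by rewrite [RHS]normrEsg. Qed.

Lemma vol_gt0 z : U z -> 0 < vol z.
Proof.
by move=> Uz; rewrite /vol signature_det sqrtr_gt0 normr_gt0 (finsler_det FF Uz).
Qed.

Lemma vol_sqr z : vol z ^+ 2 = signature F z * \det (metric F z).
Proof. by rewrite /vol signature_det sqr_sqrtr. Qed.

Lemma signature_sqr z : U z -> signature F z ^+ 2 = 1.
Proof. by move=> Uz; rewrite /signature sqr_sg (finsler_det FF Uz). Qed.

Lemma m_low0 z : m_low F 0 z = - (vol z * z.2 0 1 / F z).
Proof. by rewrite /m_low eqxx /ell_up -mulrA mulNr. Qed.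

Lemma m_low1 z : m_low F 1 z = vol z * z.2 0 0 / F z.
Proof. by rewrite /m_low /= /ell_up -mulrA. Qed.

Lemma m_upP i z : U z ->
  metric F z i 0 * m_up F 0 z + metric F z i 1 * m_up F 1 z = m_low F i z.
Proof.
move=> Uz; pose b := \col_i m_low F i z.
have gu : metric F z \in unitmx by rewrite unitmxE unitfE (finsler_det FF Uz).
have mE j : m_up F j z = (invmx (metric F z) *m b) j 0.
  rewrite /m_up /inv_metric [RHS]mxE; apply: eq_bigr => l _.
  by congr (_ * _); rewrite mxE.
have := congr1 (fun A : 'cV_2 => A i 0) (mulKVmx gu b).
rewrite /= mxE [RHS]mxE sum_ord2 => <-; rewrite !mE.
by move: (_ *m b) => X; move: (metric F z) => g.
Qed.

#[local] Opaque dx dy spray_coef.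

Lemma dy_on f h i z : U z -> (forall w, U w -> f w = h w) -> dy i f z = dy i h z.
Proof.
move=> Uz fh; exact: (@near_eq_derive _ _ _ f h z _ (near_eq_on oU Uz fh)).
Qed.

Lemma dy_sqF i z : U z -> dy i L z = 2 * F z * dy i F z.
Proof.
move=> Uz.
have [_ D] : deriv_at L z (0, delta_mx 0 i) (2 * F z * dy i F z).
  apply: (@deriv_at_on _ _ U (fun w => F w * F w)) => //.
  by apply: deriv_at_eq; [deriv_tac|gen_atoms; ring].
exact: D.
Qed.

Lemma euler_F z : U z -> z.2 0 0 * dy 0 F z + z.2 0 1 * dy 1 F z = F z.
Proof.
move=> Uz; rewrite (euler_nat (n := 1) sF Uz) ?mul1r// => k k0.
by rewrite expr1; exact: finsler_hom FF _ _ k0 Uz.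
Qed.

Lemma sqF_hom1 i k z : 0 < k -> U z -> dy i L (fiber_scale k z) = k ^+ 1 * dy i L z.
Proof.
move=> k0 Uz; rewrite (hom_dy FF i k0 sL (sqF_hom FF k0) Uz); congr (_ * _).
by field; rewrite gt_eqF.
Qed.

(** Twice the identity g_ij y^j = F d.i F. *)
Lemma euler_dy_sqF i z : U z ->
  z.2 0 0 * dy i (dy 0 L) z + z.2 0 1 * dy i (dy 1 L) z = 2 * F z * dy i F z.
Proof.
move=> Uz; have E := euler_nat (n := 1) (smooth_dy i sL) Uz
  (fun k (k0 : 0 < k) => sqF_hom1 i k0 Uz).
move: (dy_dy i 0 oU sL Uz) (dy_dy i 1 oU sL Uz) E; rewrite mul1r (dy_sqF i Uz).
by gen_atoms => -> ->.
Qed.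

(** As m is vol / F times the rotated y, the cofactors in Cramer's rule recombine to g_ij y^j = F
    d.i F. The remaining factor vol / det g is eps / vol. *)
Lemma m_upE z : U z ->
  m_up F 0 z = - (signature F z / vol z * dy 1 F z) /\
  m_up F 1 z = signature F z / vol z * dy 0 F z.
Proof.
move=> Uz; have D0 := finsler_det FF Uz.
have s0 : vol z != 0 by rewrite gt_eqF// vol_gt0.
have f0 := finsler_neq0 FF Uz.
have D1 := D0; rewrite det_mx2 in D1.
have [-> ->] := cramer2 D1 (m_upP 0 Uz) (m_upP 1 Uz).
rewrite m_low0 m_low1 -det_mx2.
have -> : signature F z / vol z = vol z / \det (metric F z).
  by apply/eqP; rewrite eqr_div// -expr2 vol_sqr.
rewrite !metricE.
move: (euler_dy_sqF 0 Uz) (euler_dy_sqF 1 Uz) (dy_dy 0 1 oU sL Uz) D0 f0.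
move: (\det _) (vol z) (F z) => D s f; gen_atoms.
move: (z.2 0 0) (z.2 0 1) => y0 y1 E0 E1 E2 D0 f0; rewrite E2 in E0 *.
have half (a b : R) : a = 2 * f * b -> b = a / (2 * f) by move=> ->; field.
by rewrite (half _ _ E0) (half _ _ E1); split; field; rewrite D0 f0.
Qed.

Lemma semi2E h z : U z -> semi2 F h z = F z / vol z * wedge h z.
Proof.
move=> Uz; have e2 := signature_sqr Uz.
rewrite /semi2 sum_ord2 /wedge; have [-> ->] := m_upE Uz.
move: e2; move: (signature F z) (vol z)^-1 (F z) => e s f; gen_atoms => e2.
by ring: e2.
Qed.

Lemma comma2E h z : U z -> comma2 F h z =
  (vol z)^-1 * (delta F 1 h z * dy 0 F z - delta F 0 h z * dy 1 F z).
Proof.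
move=> Uz; have e2 := signature_sqr Uz.
rewrite /comma2 sum_ord2; have [-> ->] := m_upE Uz.
move: e2; move: (signature F z) (vol z)^-1 (delta F 1 h z) (delta F 0 h z) => e s d1 d0.
by gen_atoms => e2; ring: e2.
Qed.

End Frame.

Arguments vol {R} F z.
Arguments wedge {R} F h z.

(** * The Cartan tensor and the main scalar *)

Section MainScalar.
Context {R : realType}.
Local Notation TU := ('rV[R]_2 * 'rV[R]_2)%type.
Context {U : set TU} {F : TU -> R} (FF : finsler_on U F).
Implicit Types (f h : TU -> R) (z v : TU) (i j k : 'I_2).
Local Notation L := (sqF F).
Let oU := finsler_open FF.
Let sF := finsler_smooth FF.
Let sL := sqF_smooth FF.

#[local] Opaque dx dy spray_coef.

Lemma cartanE i j k z : U z -> cartan F i j k z = 4^-1 * dy k (dy i (dy j L)) z.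
Proof.
move=> Uz; rewrite /cartan.
have -> : (fun w => metric F w i j) = (fun w => 2^-1 * dy i (dy j L) w).
  by apply/funext => w; exact: metricE.
have [_ D] : deriv_at (fun w => 2^-1 * dy i (dy j L) w) z (0, delta_mx 0 k)
    (2^-1 * dy k (dy i (dy j L)) z).
  by apply: deriv_at_eq; [deriv_tac|gen_atoms; ring].
by rewrite [X in _ * X = _]D; gen_atoms; field.
Qed.

(** Symmetry leaves four components, and contraction with y expresses three of them by the fourth.
    The covector n spans the annihilator of y, so it is proportional to m; this is where dimension
    two makes a main scalar exist. *)
Lemma cubic_tensor (t : 'I_2 -> 'I_2 -> 'I_2 -> R) (y0 y1 : R) :
  (y0 != 0) || (y1 != 0) ->
  (forall k i j, t k i j = t i k j) -> (forall k i j, t k i j = t k j i) ->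
  (forall i j, y0 * t 0 i j + y1 * t 1 i j = 0) ->
  let n i := if i == 0 :> 'I_2 then - y1 else y0 in
  exists c, forall k i j, t k i j = c * n k * n i * n j.
Proof.
move=> y_neq0 t1 t2 ty n.
have e001 : t 0 1 0 = t 0 0 1 by rewrite t2.
have e100 : t 1 0 0 = t 0 0 1 by rewrite t1 t2.
have e110 : t 1 1 0 = t 0 1 1 by rewrite t2 t1.
have e101 : t 1 0 1 = t 0 1 1 by rewrite t1.
have [y0_neq0|/negPn/eqP y00] := boolP (y0 != 0).
(* [t 1 1 1] must be c times the cube of [n 1 = y0]; in the other case [t 0 0 0] and [n 0 = - y1]
   determine c. *)
- exists (t 1 1 1 / y0 ^+ 3).
  have := ty 0 0; have := ty 0 1; have := ty 1 1.
  rewrite e100 e101 => a b c.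
  have solve (x t' : R) : y0 * x + y1 * t' = 0 -> x = - y1 / y0 * t'.
    move=> h; have -> : x = (y0 * x + y1 * t') / y0 - y1 / y0 * t' by field.
    by rewrite h; ring.
  have a' := solve _ _ a; have b' := solve _ _ b; have c' := solve _ _ c.
  move=> k i j; rewrite /n; case: (ord2P k) => ->; case: (ord2P i) => ->;
  case: (ord2P j) => ->; rewrite /= ?e001 ?e100 ?e110 ?e101 ?c' ?b' ?a'; field; exact: y0_neq0.
- have y1_neq0 : y1 != 0 by move: y_neq0; rewrite y00 eqxx.
  exists (- t 0 0 0 / y1 ^+ 3).
  have := ty 0 0; have := ty 0 1; have := ty 1 1.
  rewrite y00 !mul0r !add0r e100 e101.
  move=> /eqP; rewrite mulf_eq0 (negPf y1_neq0) /= => /eqP a.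
  move=> /eqP; rewrite mulf_eq0 (negPf y1_neq0) /= => /eqP b.
  move=> /eqP; rewrite mulf_eq0 (negPf y1_neq0) /= => /eqP c.
  move=> k i j; rewrite /n; case: (ord2P k) => ->; case: (ord2P i) => ->;
  case: (ord2P j) => ->; rewrite /= ?e001 ?e100 ?e110 ?e101 ?c ?b ?a ?y00; field; exact: y1_neq0.
Qed.

Lemma y_neq0 z : U z -> (z.2 0 0 != 0) || (z.2 0 1 != 0).
Proof.
move=> Uz; have := finsler_neq0 FF Uz; rewrite -(euler_F FF Uz).
move: (z.2 0 0) (z.2 0 1) => y0 y1; gen_atoms; apply: contra_neqT.
by move=> /norP[/negPn/eqP -> /negPn/eqP ->]; rewrite !mul0r addr0.
Qed.

Lemma euler_dy2_sqF i j z : U z ->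
  z.2 0 0 * dy 0 (dy i (dy j L)) z + z.2 0 1 * dy 1 (dy i (dy j L)) z = 0.
Proof.
move=> Uz; rewrite (euler_nat (n := 0) (smooth_dy i (smooth_dy j sL)) Uz) ?mul0r//.
move=> k k0; rewrite expr0.
rewrite (hom_dy FF i k0 (smooth_dy j sL) (fun w Uw => sqF_hom1 FF j k0 Uw) Uz).
by rewrite expr1 divff// gt_eqF.
Qed.

(** [main_scalar] falls back to 0 when no scalar fits, so existence has to be shown: third fibre
    derivatives of L are symmetric, and y kills them because second ones have degree 0. *)
Lemma main_scalarP z : U z -> forall i j k, F z * cartan F i j k z =
  main_scalar F z * m_low F i z * m_low F j z * m_low F k z.
Proof.
move=> Uz.
have [c tE] := @cubic_tensor (fun k i j => dy k (dy i (dy j L)) z) _ _ (y_neq0 Uz)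
  (fun k i j => dy_dy k i oU (smooth_dy j sL) Uz)
  (fun k i j => dy_on FF k Uz (fun w Uw => dy_dy i j oU sL Uw))
  (fun i j => euler_dy2_sqF i j Uz).
have s0 : vol F z != 0 by rewrite gt_eqF// (vol_gt0 FF).
have f0 := finsler_neq0 FF Uz.
have ex : exists I, forall i j k, F z * cartan F i j k z =
    I * m_low F i z * m_low F j z * m_low F k z.
  (* C is a quarter of the third derivative of L, and n = (F / vol) m contributes the cube of F /
     vol. *)
  exists (4^-1 * c * F z ^+ 4 / vol F z ^+ 3) => i j k.
  have mE l : m_low F l z = vol F z / F z * (if l == 0 then - z.2 0 1 else z.2 0 0).
    by case: (ord2P l) => ->; rewrite ?m_low0 ?m_low1 /=; field.
  rewrite cartanE// tE !mE.
  move: s0 f0; move: (vol F z) (F z) => s f.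
  move: (if i == 0 then _ else _) (if j == 0 then _ else _) (if k == 0 then _ else _).
  by move=> a b d s0 f0; field; rewrite s0 f0.
rewrite /main_scalar; case: xgetP => [I _ hI //|none].
by case: ex => I hI; case: (none I).
Qed.

End MainScalar.

(** * The derivative of the area density and the scalar sigma *)

Section Sigma.
Context {R : realType}.
Local Notation TU := ('rV[R]_2 * 'rV[R]_2)%type.
Context {U : set TU} {F : TU -> R} (FF : finsler_on U F).
Implicit Types (f h : TU -> R) (z v : TU) (i j k : 'I_2).
Local Notation L := (sqF F).
Let oU := finsler_open FF.
Let sF := finsler_smooth FF.
Let sL := sqF_smooth FF.

#[local] Opaque dx dy spray_coef.

Lemma det_metricE f z : \det (metric f z) = 4^-1 *
  (dy 0 (dy 0 (sqF f)) z * dy 1 (dy 1 (sqF f)) z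
   - dy 0 (dy 1 (sqF f)) z * dy 1 (dy 0 (sqF f)) z).
Proof. by rewrite det_mx2 !metricE; gen_atoms; field. Qed.

(** Jacobi's formula with d.k g_ij = (2 I m_k / F) m_i m_j. Because m is the rotated y, the adjugate
    of g evaluated on m is (vol / F)^2 g_ij y^i y^j = vol^2. Here [a b c d] are the entries of the
    Hessian of L and [m] is m_k. *)
Lemma det_derivative_algebra (a b c d t00 t01 t10 t11 y0 y1 F0 F1 f s I m : R) :
  f != 0 -> y0 * a + y1 * b = 2 * f * F0 -> y0 * c + y1 * d = 2 * f * F1 ->
  y0 * F0 + y1 * F1 = f ->
  4^-1 * t00 = I * - (s * y1 / f) * - (s * y1 / f) * m / f ->
  4^-1 * t01 = I * - (s * y1 / f) * (s * y0 / f) * m / f ->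
  4^-1 * t10 = I * (s * y0 / f) * - (s * y1 / f) * m / f ->
  4^-1 * t11 = I * (s * y0 / f) * (s * y0 / f) * m / f ->
  4^-1 * (t00 * d + a * t11 - (t01 * c + b * t10)) = 2 * I * m * s ^+ 2 / f.
Proof.
move=> f0 E0 E1 E e00 e01 e10 e11.
transitivity (4^-1 * t00 * d + a * (4^-1 * t11) - (4^-1 * t01 * c + b * (4^-1 * t10))).
  by ring.
rewrite e00 e01 e10 e11.
transitivity (I * m * s ^+ 2 / f ^+ 3 * (y0 * (y0 * a + y1 * b) + y1 * (y0 * c + y1 * d))).
  by field.
rewrite E0 E1.
transitivity (I * m * s ^+ 2 / f ^+ 3 * (2 * f * (y0 * F0 + y1 * F1))); first by ring.
by rewrite E; field.
Qed.

Lemma deriv_at_det k z : U z ->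
  deriv_at (fun w => \det (metric F w)) z (0, delta_mx 0 k)
    (2 * main_scalar F z * m_low F k z * vol F z ^+ 2 / F z).
Proof.
move=> Uz; rewrite (funext (fun w => det_metricE F w)).
have f0 := finsler_neq0 FF Uz.
have tE i j : 4^-1 * dy k (dy i (dy j L)) z =
    main_scalar F z * m_low F i z * m_low F j z * m_low F k z / F z.
  by apply: (mulfI f0); rewrite -(cartanE FF)// (main_scalarP FF)// [RHS]mulrCA divff ?mulr1.
move: (tE 0 0) (tE 0 1) (tE 1 0) (tE 1 1).
rewrite m_low0 m_low1 => t00 t01 t10 t11.
have <- := det_derivative_algebra f0 (euler_dy_sqF FF 0 Uz) (euler_dy_sqF FF 1 Uz)
  (euler_F FF Uz) t00 t01 t10 t11.
apply: deriv_at_eq; first by deriv_tac.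
by gen_atoms; ring.
Qed.

Lemma deriv_at_vol k z : U z -> deriv_at (vol F) z (0, delta_mx 0 k)
  (signature F z * main_scalar F z * m_low F k z * vol F z / F z).
Proof.
move=> Uz; have dD := deriv_at_det k Uz.
(* The signature is frozen at z: this function is differentiable and stays positive near z, where
   its square root is [vol]. *)
pose g w := signature F z * \det (metric F w).
have dg : deriv_at g z (0, delta_mx 0 k)
    (signature F z * (2 * main_scalar F z * m_low F k z * vol F z ^+ 2 / F z)).
  apply: deriv_at_eq (deriv_atM (deriv_at_cst _ _ _) dD) _.
  by rewrite mul0r add0r.
have s0 := vol_gt0 FF Uz.
have g0 : 0 < g z by have := exprn_gt0 2 s0; rewrite vol_sqr.
have gnear : \forall w \near z, 0 < g w.
  have cg : {for z, continuous g} by apply: differentiable_continuous; exact: dg.1.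
  have /cvgrPdist_lt/(_ _ g0) := cg; apply: filterS => w /= gw.
  by have := le_lt_trans (ler_norm _) gw; rewrite ltrBlDr ltrDl.
have gE : \near z, Num.sqrt (g z) = vol F z.
  have Unear : \forall w \near z, U w by apply: open_nbhs_nbhs.
  apply: filterS2 gnear Unear => w gw Uw; rewrite /vol signature_det.
  rewrite -(gtr0_norm gw) /g normrM.
  have -> : `|signature F z| = 1.
    by apply/eqP; rewrite -sqrp_eq1// real_normK ?num_real// (signature_sqr FF).
  by rewrite mul1r.
apply: (deriv_at_near gE); apply: deriv_at_eq (deriv_at_comp dg (is_derive1_sqrt g0)) _.
rewrite -/(vol F z); have f0 := finsler_neq0 FF Uz.
move: (gt_eqF s0) f0; rewrite /g -/(vol F z).
move: (main_scalar F z) (m_low F k z) (vol F z) (F z) (signature F z) => I m s f e.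
by move=> /negbT s_neq0 f0; field; rewrite s_neq0 f0.
Qed.

(** The left-hand side is sigma + eps - (h_{;2})^2 with h_{;2} = (f / s) X differentiated by the
    product rule; [X0] and [X1] are the fibre derivatives of X = [wedge F h]. *)
Lemma sigma_algebra (f s D e I X X0 X1 F0 F1 y0 y1 : R) :
  f != 0 -> s != 0 -> D != 0 -> s ^+ 2 = e * D -> e ^+ 2 = 1 -> y0 * F0 + y1 * F1 = f ->
  f / s * ((F1 / s * X + f * (- (e * I * (s * y0 / f) * s / f) / s ^+ 2) * X + f / s * X1) * F0
    - (F0 / s * X + f * (- (e * I * - (s * y1 / f) * s / f) / s ^+ 2) * X + f / s * X0) * F1)
  + e * I * (f / s * X) + 2 * (f / s * X) ^+ 2 + e - (f / s * X) ^+ 2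
  = e * (f ^+ 2 * (X1 * F0 - X0 * F1) + X ^+ 2 * f ^+ 2 + D) / D.
Proof.
move=> f0 s0 D0 s2 e2 E.
have DE : D = e * s ^+ 2 by rewrite s2 mulrA -expr2 e2 mul1r.
have e0 : e != 0 by move: D0; rewrite DE mulf_eq0 negb_or => /andP[].
transitivity (f / s * (- e * I * X / f * (y0 * F0 + y1 * F1) + f / s * (X1 * F0 - X0 * F1))
  + e * I * (f / s * X) + (f / s * X) ^+ 2 + e); first by field; rewrite s0 f0.
by rewrite E DE; field; rewrite s0 f0 e0.
Qed.

(** This is e^(-4h) times the determinant of the metric of e^h F ([conformal_det_metric]), written
    without main scalar and square roots. *)
Definition conformal_det h z : R :=
  F z ^+ 2 * wedge F (wedge F h) z + wedge F h z ^+ 2 * F z ^+ 2 + \det (metric F z).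

Lemma wedge_smooth h : smooth_on U h -> smooth_on U (wedge F h).
Proof. by move=> sh; rewrite /wedge; smooth_tac. Qed.

(* The term of sigma with the main scalar cancels the derivative of [vol]. *)
Lemma sigmaE h z : smooth_on U h -> U z ->
  sigma F h z + signature F z - semi2 F h z ^+ 2 =
  signature F z * conformal_det h z / \det (metric F z).
Proof.
move=> sh Uz; have f0 := finsler_neq0 FF Uz; have D0 := finsler_det FF Uz.
have s0 : vol F z != 0 by rewrite gt_eqF// (vol_gt0 FF).
have sX := wedge_smooth sh.
have cE i : dy i (semi2 F h) z = dy i F z / vol F z * wedge F h z
    + F z * (- (signature F z * main_scalar F z * m_low F i z * vol F z / F z)
             / vol F z ^+ 2) * wedge F h z
    + F z / vol F z * dy i (wedge F h) z.
  have [_ D] : deriv_at (semi2 F h) z (0, delta_mx 0 i)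
      (dy i F z / vol F z * wedge F h z
       + F z * (- (signature F z * main_scalar F z * m_low F i z * vol F z / F z)
             / vol F z ^+ 2) * wedge F h z
       + F z / vol F z * dy i (wedge F h) z).
    apply: (@deriv_at_on _ _ U (fun w => F w * (vol F w)^-1 * wedge F h w)) => //.
      by move=> w Uw; rewrite (semi2E FF).
    apply: deriv_at_eq; last by rewrite -mulrDl.
    apply: deriv_atM (smooth_deriv_at_dy i sX Uz).
    exact: deriv_atM (smooth_deriv_at_dy i sF Uz) (deriv_atV s0 (deriv_at_vol i Uz)).
  exact: D.
rewrite /sigma [semi2 F (semi2 F h) z](semi2E FF _ Uz) {1}/wedge !cE m_low0 m_low1.
rewrite (semi2E FF _ Uz) /conformal_det.
exact: sigma_algebra f0 s0 D0 (vol_sqr z) (signature_sqr FF Uz) (euler_F FF Uz).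
Qed.

End Sigma.

Arguments conformal_det {R} F h z.

(** * The conformal change *)

Section ConformalDeterminant.
Context {R : realType}.
Local Notation TU := ('rV[R]_2 * 'rV[R]_2)%type.
Context {U : set TU} {F : TU -> R} (FF : finsler_on U F).
Context {h Fb : TU -> R} (sh : smooth_on U h)
  (h_hom : forall k z, 0 < k -> U z -> h (fiber_scale k z) = h z)
  (FbE : forall z, U z -> Fb z = expR (h z) * F z).
Implicit Types (z v : TU) (i j k : 'I_2).
Local Notation L := (sqF F).
Local Notation Lb := (sqF Fb).
Let oU := finsler_open FF.
Let sF := finsler_smooth FF.
Let sL := sqF_smooth FF.
Let w z := expR (h z).
Let sw : smooth_on U w. Proof. exact: smooth_on_expR. Qed.

Lemma conformal_sqF z : U z -> Lb z = w z ^+ 2 * L z.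
Proof. by move=> Uz; rewrite /sqF FbE// exprMn. Qed.

Lemma deriv_at_exp z v : U z -> deriv_at w z v (w z * 'D_v h z).
Proof.
move=> Uz; exact: (deriv_at_comp (smooth_on_deriv_at v sh Uz) (is_derive_expR _)).
Qed.

Lemma deriv_at_conformal_sqF z v : U z ->
  deriv_at Lb z v (2 * Lb z * 'D_v h z + w z ^+ 2 * 'D_v L z).
Proof.
move=> Uz; apply: (@deriv_at_on _ _ U (fun u => w u * w u * L u)) => //.
  by move=> u Uu; rewrite conformal_sqF// expr2.
have dw := deriv_at_exp v Uz.
apply: deriv_at_eq (deriv_atM (deriv_atM dw dw) (smooth_on_deriv_at v sL Uz)) _.
rewrite conformal_sqF//; move: ('D_v h z) ('D_v L z) (L z) (w z) => a b c d; ring.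
Qed.

Lemma dy_conformal_sqF i z : U z ->
  dy i Lb z = 2 * Lb z * dy i h z + w z ^+ 2 * dy i L z.
Proof. by move=> Uz; have [_] := deriv_at_conformal_sqF (0, delta_mx 0 i) Uz. Qed.

Lemma dx_conformal_sqF i z : U z ->
  dx i Lb z = 2 * Lb z * dx i h z + w z ^+ 2 * dx i L z.
Proof. by move=> Uz; have [_] := deriv_at_conformal_sqF (delta_mx 0 i, 0) Uz. Qed.

Lemma dy_exp i z : U z -> dy i w z = w z * dy i h z.
Proof. by move=> Uz; have [_] := deriv_at_exp (0, delta_mx 0 i) Uz. Qed.

#[local] Opaque dx dy spray_coef.

Lemma dy2_sqF i j z : U z ->
  dy i (dy j L) z = 2 * (dy i F z * dy j F z + F z * dy i (dy j F) z).
Proof.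
move=> Uz; rewrite (dy_on FF i Uz (fun u Uu => dy_sqF FF j Uu)).
have [_ D] : deriv_at (fun u => 2 * F u * dy j F u) z (0, delta_mx 0 i)
    (2 * (dy i F z * dy j F z + F z * dy i (dy j F) z)).
  by apply: deriv_at_eq; [deriv_tac|gen_atoms; ring].
exact: D.
Qed.

Lemma dy2_conformal_sqF i j z : U z -> dy i (dy j Lb) z = 2 * w z ^+ 2 * (
  2 * dy i h z * (F z ^+ 2 * dy j h z + F z * dy j F z)
  + 2 * F z * dy i F z * dy j h z + F z ^+ 2 * dy i (dy j h) z
  + dy i F z * dy j F z + F z * dy i (dy j F) z).
Proof.
move=> Uz.
(* Powers are spelled out as products for [deriv_tac]. *)
pose f u := 2 * (w u * w u) * (F u * F u * dy j h u + F u * dy j F u).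
have LE u : U u -> dy j Lb u = f u.
  move=> Uu; rewrite dy_conformal_sqF// conformal_sqF// (dy_sqF FF)// /f /sqF.
  by move: (w u) (F u) => a b; gen_atoms; ring.
rewrite (dy_on FF i Uz LE).
have [_ D] : deriv_at f z (0, delta_mx 0 i) (2 * w z ^+ 2 * (
  2 * dy i h z * (F z ^+ 2 * dy j h z + F z * dy j F z)
  + 2 * F z * dy i F z * dy j h z + F z ^+ 2 * dy i (dy j h) z
  + dy i F z * dy j F z + F z * dy i (dy j F) z)).
  rewrite /f; apply: deriv_at_eq; first by deriv_tac.
  rewrite dy_exp//; move: (w z) (F z) => a b; gen_atoms; ring.
exact: D.
Qed.

Lemma dy_wedge i z : U z -> dy i (wedge F h) z =
  dy i (dy 1 h) z * dy 0 F z + dy 1 h z * dy i (dy 0 F) z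
  - (dy i (dy 0 h) z * dy 1 F z + dy 0 h z * dy i (dy 1 F) z).
Proof.
move=> Uz.
have [_ D] : deriv_at (wedge F h) z (0, delta_mx 0 i)
    (dy i (dy 1 h) z * dy 0 F z + dy 1 h z * dy i (dy 0 F) z
    - (dy i (dy 0 h) z * dy 1 F z + dy 0 h z * dy i (dy 1 F) z)).
  by rewrite /wedge; apply: deriv_at_eq; [deriv_tac|gen_atoms; ring].
exact: D.
Qed.

Lemma euler_dy_F i z : U z ->
  z.2 0 0 * dy 0 (dy i F) z + z.2 0 1 * dy 1 (dy i F) z = 0.
Proof.
move=> Uz; rewrite (euler_nat (n := 0) (smooth_dy i sF) Uz) ?mul0r// => k k0.
rewrite (hom_dy FF i k0 sF (fun u Uu => finsler_hom FF k0 Uu) Uz).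
by rewrite divff ?gt_eqF// expr0.
Qed.

Lemma euler_h z : U z -> z.2 0 0 * dy 0 h z + z.2 0 1 * dy 1 h z = 0.
Proof.
move=> Uz; rewrite (euler_nat (n := 0) sh Uz) ?mul0r// => k k0.
by rewrite h_hom// expr0 mul1r.
Qed.

(** The fibre derivatives of h have degree -1, hence the factor 1 / t, whose derivative at 1 is
    -1. *)
Lemma euler_dy_h i z : U z ->
  z.2 0 0 * dy 0 (dy i h) z + z.2 0 1 * dy 1 (dy i h) z = - dy i h z.
Proof.
move=> Uz; have dV : is_derive (1 : R) (1 : R) (fun t : R => 1 / t) (-1).
  have [df fE] : deriv_at (fun t : R => 1 / t) 1 1 (-1).
    have d1 : deriv_at (fun t : R => t) 1 1 1.
      by split; [exact: (@ex_diff _ _ _ _ _ id)|exact: derive_id].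
    apply: deriv_at_eq.
      exact: deriv_atM (deriv_at_cst _ _ _) (deriv_atV (oner_neq0 _) d1).
    by rewrite expr1n invr1; ring.
  by apply: DeriveDef => //; exact: diff_derivable.
rewrite -mulN1r; apply: (euler _ _ dV).
  exact: smooth_on_differentiable (smooth_dy i sh) Uz.
move=> k k0; apply: (hom_dy FF i k0 sh _ Uz) => u Uu.
by rewrite h_hom// mul1r.
Qed.

(** The identity holds modulo Euler's relations, which leave one free second fibre derivative of F
    and one of h. They are solved by dividing by a nonzero component of y, whence the two cases. *)
Lemma conformal_det_algebra
    (u f F0 F1 F00 F01 F11 p0 p1 p00 p01 p11 y0 y1 : R) :
  (y0 != 0) || (y1 != 0) ->
  y0 * F0 + y1 * F1 = f -> y0 * F00 + y1 * F01 = 0 -> y0 * F01 + y1 * F11 = 0 ->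
  y0 * p0 + y1 * p1 = 0 -> y0 * p00 + y1 * p01 = - p0 -> y0 * p01 + y1 * p11 = - p1 ->
  let Lb00 := 2 * u ^+ 2 * (2 * p0 * (f ^+ 2 * p0 + f * F0) + 2 * f * F0 * p0
    + f ^+ 2 * p00 + F0 * F0 + f * F00) in
  let Lb01 := 2 * u ^+ 2 * (2 * p0 * (f ^+ 2 * p1 + f * F1) + 2 * f * F0 * p1
    + f ^+ 2 * p01 + F0 * F1 + f * F01) in
  let Lb10 := 2 * u ^+ 2 * (2 * p1 * (f ^+ 2 * p0 + f * F0) + 2 * f * F1 * p0
    + f ^+ 2 * p01 + F1 * F0 + f * F01) in
  let Lb11 := 2 * u ^+ 2 * (2 * p1 * (f ^+ 2 * p1 + f * F1) + 2 * f * F1 * p1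
    + f ^+ 2 * p11 + F1 * F1 + f * F11) in
  4^-1 * (Lb00 * Lb11 - Lb01 * Lb10) = u ^+ 4 * (f ^+ 2 *
    ((p11 * F0 + p1 * F01 - (p01 * F1 + p0 * F11)) * F0
     - (p01 * F0 + p1 * F00 - (p00 * F1 + p0 * F01)) * F1)
    + (p1 * F0 - p0 * F1) ^+ 2 * f ^+ 2
    + 4^-1 * (2 * (F0 * F0 + f * F00) * (2 * (F1 * F1 + f * F11))
              - 2 * (F0 * F1 + f * F01) * (2 * (F1 * F0 + f * F01)))).
Proof.
have solve (a b x t c : R) : a != 0 -> a * x + b * t = c -> x = (c - b * t) / a.
  by move=> a0 <-; field.
move=> + E0 E1 E2 E3 E4 E5 /=.
case/orP => [y0_neq0|y1_neq0].
  rewrite (solve _ _ _ _ _ y0_neq0 E1) (solve _ _ _ _ _ y0_neq0 E2).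
  rewrite (solve _ _ _ _ _ y0_neq0 E4) (solve _ _ _ _ _ y0_neq0 E5).
  by rewrite (solve _ _ _ _ _ y0_neq0 E3) -E0; field.
(* The same elimination with the two coordinates exchanged. *)
rewrite addrC in E1; rewrite addrC in E2; rewrite addrC in E3.
rewrite addrC in E4; rewrite addrC in E5.
rewrite (solve _ _ _ _ _ y1_neq0 E2) (solve _ _ _ _ _ y1_neq0 E1).
rewrite (solve _ _ _ _ _ y1_neq0 E5) (solve _ _ _ _ _ y1_neq0 E4).
by rewrite (solve _ _ _ _ _ y1_neq0 E3) -E0; field.
Qed.

Lemma conformal_det_metric z : U z ->
  \det (metric Fb z) = expR (h z) ^+ 4 * conformal_det F h z.
Proof.
move=> Uz; rewrite det_metricE.
have -> : conformal_det F h z =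
    F z ^+ 2 * (dy 1 (wedge F h) z * dy 0 F z - dy 0 (wedge F h) z * dy 1 F z)
    + (dy 1 h z * dy 0 F z - dy 0 h z * dy 1 F z) ^+ 2 * F z ^+ 2 + \det (metric F z).
  by [].
rewrite det_metricE -/(w z).
move: (y_neq0 FF Uz) (euler_F FF Uz) (euler_dy_F 0 Uz) (euler_dy_F 1 Uz).
move: (euler_h Uz) (euler_dy_h 0 Uz) (euler_dy_h 1 Uz).
move: (dy2_conformal_sqF 0 0 Uz) (dy2_conformal_sqF 0 1 Uz) (dy2_conformal_sqF 1 0 Uz)
  (dy2_conformal_sqF 1 1 Uz) (dy2_sqF 0 0 Uz) (dy2_sqF 0 1 Uz) (dy2_sqF 1 0 Uz)
  (dy2_sqF 1 1 Uz) (dy_wedge 0 Uz) (dy_wedge 1 Uz) (dy_dy 1 0 oU sF Uz)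
  (dy_dy 1 0 oU sh Uz).
gen_atoms; move: (w z) (F z) (z.2 0 0) (z.2 0 1) => u f y0 y1.
move=> + + + + + + + + + + eF eh; rewrite eF eh.
move=> -> -> -> -> -> -> -> -> -> -> e3 e4 e5 y0' e0 e1 e2.
exact: conformal_det_algebra y0' e0 e1 e2 e3 e4 e5.
Qed.

Lemma conformal_finsler :
  (forall z, U z -> sigma F h z + signature F z - semi2 F h z ^+ 2 != 0) ->
  finsler_on U Fb.
Proof.
move=> sigma0; split => //.
- exact: finsler_cone FF.
- apply: (smooth_on_ext (f := fun u => w u * F u)) => //; last by smooth_tac.
  by move=> u Uu; rewrite FbE.
- by move=> z Uz; rewrite FbE// mulf_neq0 ?(finsler_neq0 FF)// gt_eqF// expR_gt0.
- move=> k z k0 Uz; rewrite !FbE//; last exact: (finsler_cone FF).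
  by rewrite h_hom// (finsler_hom FF)// mulrCA.
- move=> z Uz; rewrite conformal_det_metric// mulf_neq0//.
    by rewrite expf_neq0// gt_eqF// expR_gt0.
  have := sigma0 z Uz; rewrite (sigmaE FF)//; apply: contra_neq => ->.
  by rewrite mulr0 mul0r.
Qed.

End ConformalDeterminant.

(** * Comparison of the sprays of F and Fbar *)

Section ConformalSpray.
Context {R : realType}.
Local Notation TU := ('rV[R]_2 * 'rV[R]_2)%type.
Context {U : set TU} {F : TU -> R} (FF : finsler_on U F).
Context {h Fb : TU -> R} (sh : smooth_on U h)
  (h_hom : forall k z, 0 < k -> U z -> h (fiber_scale k z) = h z)
  (FbE : forall z, U z -> Fb z = expR (h z) * F z) (FFb : finsler_on U Fb).
Implicit Types (z v : TU) (i j k : 'I_2).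
Local Notation L := (sqF F).
Local Notation Lb := (sqF Fb).
Local Notation T := (spray_deriv F h).
Let oU := finsler_open FF.
Let sF := finsler_smooth FF.
Let sL := sqF_smooth FF.
Let sLb := sqF_smooth FFb.
Let sT : smooth_on U T. Proof. exact: spray_deriv_smooth. Qed.

#[local] Opaque dx dy spray_coef.

(** S is a derivation that kills L, so on Lbar = e^(2h) L it acts through the exponent alone; the
    same holds for delta_i in [delta_conformal]. *)
Lemma spray_deriv_conformal z : U z -> spray_deriv F Lb z = 2 * Lb z * T z.
Proof.
move=> Uz; have := spray_deriv_sqF FF Uz; rewrite /spray_deriv.
move: (dx_conformal_sqF FF sh FbE 0 Uz) (dx_conformal_sqF FF sh FbE 1 Uz).
move: (dy_conformal_sqF FF sh FbE 0 Uz) (dy_conformal_sqF FF sh FbE 1 Uz).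
move: (Lb z) (expR (h z) ^+ 2) => l w; gen_atoms => -> -> -> -> E.
set e := (X in X = 0) in E.
by rewrite -[RHS]addr0 -(mulr0 w) -E /e; ring.
Qed.

Lemma delta_conformal i z : U z -> delta F i Lb z = 2 * Lb z * delta F i h z.
Proof.
move=> Uz; have := delta_sqF FF i Uz; rewrite !deltaE.
move: (dx_conformal_sqF FF sh FbE i Uz).
move: (dy_conformal_sqF FF sh FbE 0 Uz) (dy_conformal_sqF FF sh FbE 1 Uz).
move: (Lb z) (expR (h z) ^+ 2) => l w; gen_atoms => -> -> -> E.
set e := (X in X = 0) in E.
by rewrite -[RHS]addr0 -(mulr0 w) -E /e; ring.
Qed.

Lemma dy_spray_deriv_conformal i z : U z ->
  dy i (spray_deriv F Lb) z = 2 * (dy i Lb z * T z + Lb z * dy i T z).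
Proof.
move=> Uz; rewrite (dy_on FF i Uz spray_deriv_conformal).
have [_ D] : deriv_at (fun u => 2 * Lb u * T u) z (0, delta_mx 0 i)
    (2 * (dy i Lb z * T z + Lb z * dy i T z)).
  by apply: deriv_at_eq; [deriv_tac|move: (Lb z) (T z); gen_atoms => *; ring].
exact: D.
Qed.

Lemma spray_rhs_conformal i z : U z -> spray_rhs Fb i z =
  2 * (dy i (dy 0 Lb) z * spray_coef F 0 z + dy i (dy 1 Lb) z * spray_coef F 1 z)
  + 2 * (dy i Lb z * T z + Lb z * dy i T z - 2 * Lb z * delta F i h z).
Proof.
move=> Uz; have := dy_spray_deriv FF i sLb Uz.
rewrite dy_spray_deriv_conformal// delta_conformal// /spray_rhs.
move: (Lb z) (T z) (delta F i h z) => l t d; gen_atoms => E.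
by move: E => /eqP; rewrite eq_sym => /eqP E; lra.
Qed.

Lemma dy_conformal_sqFE i z : U z ->
  dy i Lb z = 2 * Lb z * (dy i h z + dy i F z / F z).
Proof.
move=> Uz; rewrite (dy_conformal_sqF FF sh FbE)// (dy_sqF FF)//.
rewrite (conformal_sqF FbE)// /sqF; have f0 := finsler_neq0 FF Uz.
by move: (F z) (expR (h z)) f0 => f w; gen_atoms => f0; field.
Qed.

Lemma euler_T z : U z -> z.2 0 0 * dy 0 T z + z.2 0 1 * dy 1 T z = T z.
Proof.
move=> Uz; rewrite (euler_nat (n := 1) sT Uz) ?mul1r// => k k0.
apply: (spray_deriv_hom FF (n := 0)) => // u Uu.
by rewrite expr0 mul1r h_hom.
Qed.

(** Half the Euler-Lagrange expression of Fbar^2 along S, less the part accounted for by P = T / 2,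
    divided by Fbar^2. It vanishes exactly when Gbar^i = G^i + (T / 2) y^i. *)
Definition spray_defect i z : R :=
  (dy i h z + dy i F z / F z) * T z + dy i T z - 2 * delta F i h z.

Lemma spray_defect_algebra (y0 y1 f F0 F1 p0 p1 t t0 t1 d0 d1 : R) : f != 0 ->
  y0 * F0 + y1 * F1 = f -> y0 * p0 + y1 * p1 = 0 -> y0 * t0 + y1 * t1 = t ->
  y0 * d0 + y1 * d1 = t ->
  y0 * ((p0 + F0 / f) * t + t0 - 2 * d0) + y1 * ((p1 + F1 / f) * t + t1 - 2 * d1) = 0.
Proof.
move=> f0 eF ep et ed.
transitivity ((y0 * p0 + y1 * p1 + (y0 * F0 + y1 * F1) / f) * t
  + (y0 * t0 + y1 * t1) - 2 * (y0 * d0 + y1 * d1)); first by field.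
by rewrite eF ep et ed; field.
Qed.

(** The contraction is T + T - 2 T: from y^i d.i F = F, from the degree 1 of T, and from y^i delta_i
    h = T. *)
Lemma spray_defect_y z : U z ->
  z.2 0 0 * spray_defect 0 z + z.2 0 1 * spray_defect 1 z = 0.
Proof.
move=> Uz; exact: spray_defect_algebra (finsler_neq0 FF Uz) (euler_F FF Uz)
  (euler_h sh h_hom Uz) (euler_T Uz) (sum_delta FF h Uz).
Qed.

Lemma spray_rhs_algebra (A B G0 G1 p t l ti d y0 y1 q : R) :
  y0 * A + y1 * B = p -> p = 2 * l * q ->
  2 * (A * G0 + B * G1) + 2 * (p * t + l * ti - 2 * l * d) =
  2 * (A * (G0 + 2^-1 * t * y0) + B * (G1 + 2^-1 * t * y1))
  + 2 * l * (q * t + ti - 2 * d).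
Proof.
move=> E e.
have -> : 2 * l * (q * t + ti - 2 * d) = 2 * l * q * t + 2 * l * ti - 4 * l * d by ring.
by rewrite -e -E; field.
Qed.

Lemma euler_dy_conformal i z : U z ->
  z.2 0 0 * dy i (dy 0 Lb) z + z.2 0 1 * dy i (dy 1 Lb) z = dy i Lb z.
Proof. by move=> Uz; rewrite (euler_dy_sqF FFb)// (dy_sqF FFb). Qed.

(** As y^j d.i d.j Lbar = d.i Lbar, the shift of G^j by (T / 2) y^j absorbs half of the term 2 T d.i
    Lbar; the other half stays in the defect. *)
Lemma spray_rhs_defect i z : U z -> spray_rhs Fb i z =
  2 * (dy i (dy 0 Lb) z * (spray_coef F 0 z + 2^-1 * T z * z.2 0 0)
     + dy i (dy 1 Lb) z * (spray_coef F 1 z + 2^-1 * T z * z.2 0 1))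
  + 2 * Lb z * spray_defect i z.
Proof.
move=> Uz; rewrite spray_rhs_conformal//.
exact: spray_rhs_algebra (euler_dy_conformal i Uz) (dy_conformal_sqFE i Uz).
Qed.

Lemma annihilator_algebra (a b y0 y1 F0 F1 f : R) : f != 0 ->
  y0 * a + y1 * b = 0 -> y0 * F0 + y1 * F1 = f -> b * F0 = a * F1 -> a = 0 /\ b = 0.
Proof.
move=> f0 E EF Ew; split; apply: (mulfI f0); rewrite mulr0 -EF.
  transitivity (F0 * (y0 * a + y1 * b) + y1 * (a * F1 - b * F0)); first by ring.
  by rewrite E Ew; ring.
transitivity (F1 * (y0 * a + y1 * b) + y0 * (b * F0 - a * F1)); first by ring.
by rewrite E Ew; ring.
Qed.

(* Both [y^i] and [d.i F] annihilate the defect, and [y^i d.i F = F] is nonzero. *)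
Lemma spray_defect_eq0 z : U z ->
  spray_defect 1 z * dy 0 F z = spray_defect 0 z * dy 1 F z ->
  forall i, spray_defect i z = 0.
Proof.
move=> Uz; move: (spray_defect_y Uz) (euler_F FF Uz) (finsler_neq0 FF Uz).
move=> Ey EF f0 Ew i.
suff [E0 E1] : spray_defect 0 z = 0 /\ spray_defect 1 z = 0.
  by case: (ord2P i) => ->; [exact: E0|exact: E1].
exact: annihilator_algebra f0 Ey EF Ew.
Qed.

(** The term T d.i F / F of the defect and the one coming from the denominator of phi_{,1} = T / F
    are both multiples of dF, so the wedge product with dF removes them. *)
Lemma assertion_iiE z : U z ->
  semi2 F h z * comma1 F h z + semi2 F (comma1 F h) z - 2 * comma2 F h z =
  (spray_defect 1 z * dy 0 F z - spray_defect 0 z * dy 1 F z) / vol F z.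
Proof.
move=> Uz; have f0 := finsler_neq0 FF Uz.
have s0 : vol F z != 0 by rewrite gt_eqF// (vol_gt0 FF).
have cE i : dy i (comma1 F h) z = dy i T z / F z - T z * dy i F z / F z ^+ 2.
  have [_ D] : deriv_at (comma1 F h) z (0, delta_mx 0 i)
     (dy i T z / F z - T z * dy i F z / F z ^+ 2).
    apply: (@deriv_at_on _ _ U (fun w => T w * (F w)^-1)) => //.
      by move=> w Uw; rewrite (comma1E FF).
    apply: deriv_at_eq (deriv_atM (smooth_deriv_at_dy i sT Uz)
      (deriv_atV f0 (smooth_deriv_at_dy i sF Uz))) _.
    by rewrite mulNr mulrN mulrA.
  exact: D.
rewrite !(semi2E FF _ Uz) (comma2E FF _ Uz) (comma1E FF _ Uz) /wedge /spray_defect.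
move: (cE 0) (cE 1) f0 s0.
move: (F z) (vol F z) (T z) (delta F 0 h z) (delta F 1 h z) => f s t d0 d1.
gen_atoms => -> -> nf ns; field; rewrite nf ns; exact: isT.
Qed.

Lemma spray_coef_defect P z : U z ->
  (forall i, spray_coef Fb i z = spray_coef F i z + P * z.2 0 i) ->
  forall i, (P - 2^-1 * T z) * dy i Lb z = Lb z * spray_defect i z.
Proof.
move=> Uz GE i; have := spray_coefP i (finsler_det FFb Uz).
rewrite (GE 0) (GE 1) spray_rhs_defect// -euler_dy_conformal//.
move: (spray_defect i z) (T z) (Lb z) => d t l; gen_atoms => E.
by apply: (@mulfI _ 2); [rewrite pnatr_eq0|move: E => /eqP; rewrite -subr_eq0 => /eqP E;
   apply/eqP; rewrite -subr_eq0 -[X in _ == X]E; apply/eqP; field].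
Qed.

Lemma conformal_sqF_neq0 z : U z -> Lb z != 0.
Proof. by move=> Uz; rewrite /sqF expf_neq0// (finsler_neq0 FFb). Qed.

Lemma proportional_spray P z : U z ->
  (forall i, spray_coef Fb i z = spray_coef F i z + P * z.2 0 i) -> P = 2^-1 * T z.
Proof.
move=> Uz GE; have D := spray_coef_defect Uz GE.
have Ly : z.2 0 0 * dy 0 Lb z + z.2 0 1 * dy 1 Lb z = 2 * Lb z.
  rewrite !(dy_sqF FFb)// /sqF; have := euler_F FFb Uz.
  move: (Fb z) => f; gen_atoms; move: (z.2 0 0) (z.2 0 1) => y0 y1 E.
  by rewrite expr2 -[X in _ = _ * (_ * X)]E; ring.
have L0 : 2 * Lb z != 0 by rewrite mulf_neq0 ?pnatr_eq0// conformal_sqF_neq0.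
apply/eqP; rewrite -subr_eq0; apply/eqP; apply: (mulIf L0); rewrite mul0r -Ly.
move: (D 0) (D 1) (spray_defect_y Uz); move: (P - _) (Lb z) => p l.
move: (spray_defect 0 z) (spray_defect 1 z) => a b; gen_atoms => D0 D1 Dy.
by rewrite mulrDr mulrCA D0 [X in _ + X]mulrCA D1 !(mulrCA _ l) -mulrDr Dy mulr0.
Qed.

(** At each single z both sides mean that [spray_defect] vanishes. *)
Lemma assertion_ii_iii z : U z ->
  semi2 F h z * comma1 F h z + semi2 F (comma1 F h) z = 2 * comma2 F h z <->
  forall i, spray_coef Fb i z = spray_coef F i z + 2^-1 * F z * comma1 F h z * z.2 0 i.
Proof.
move=> Uz; have L0 := conformal_sqF_neq0 Uz.
have s0 : vol F z != 0 by rewrite gt_eqF// (vol_gt0 FF).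
have TE : 2^-1 * F z * comma1 F h z = 2^-1 * T z.
  by rewrite (comma1E FF)// -mulrA (mulrC (F z)) divfK// (finsler_neq0 FF).
rewrite TE; split=> [ii|iii].
  have D0 : forall i, spray_defect i z = 0.
    apply: (spray_defect_eq0 Uz).
    apply/eqP; rewrite -subr_eq0; apply/eqP; apply: (mulIf (invr_neq0 s0)).
    by rewrite mul0r -assertion_iiE// ii subrr.
  apply: (spray_coef_unique (finsler_det FFb Uz)) => i.
  by rewrite spray_rhs_defect// D0 mulr0 addr0.
have D0 i : spray_defect i z = 0.
  apply: (mulfI L0); rewrite mulr0 -(spray_coef_defect Uz iii).
  by rewrite subrr mul0r.
apply/eqP; rewrite -subr_eq0; apply/eqP; rewrite assertion_iiE//.
rewrite (D0 0) (D0 1); gen_atoms; rewrite !mul0r subrr; exact: mul0r.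
Qed.

End ConformalSpray.

(** * Changes of coordinates *)

Section VectorCalculus.
Context {R : realType}.

Lemma derive_comp (V W X : normedModType R) (p : V -> W) (g : W -> X) z v :
  differentiable p z -> differentiable g (p z) ->
  'D_v (fun w => g (p w)) z = 'D_('D_v p z) g (p z).
Proof.
move=> dp dg; rewrite deriveE; last exact: (differentiable_comp dp dg).
by rewrite [LHS](congr1 (fun F => F v) (diff_comp dp dg)) /= !deriveE.
Qed.

Lemma deriv_at_coord (V : normedModType R) (g : V -> 'rV[R]_2) z v j :
  differentiable g z -> deriv_at (fun w => g w 0 j) z v ('D_v g z 0 j).
Proof.
move=> dg; have dc : differentiable (fun u : 'rV[R]_2 => u 0 j) (g z).
  exact: differentiable_coord.
split; first exact: (differentiable_comp dg dc).
rewrite derive_mx; last exact: diff_derivable.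
by rewrite mxE.
Qed.

Lemma Cn_coord (V : normedModType R) (U : set V) n (g : V -> 'rV[R]_2) j :
  open U -> Cn n U g -> Cn n U (fun w => g w 0 j).
Proof.
move=> oU; elim: n g => [|n IH] g.
  move=> cg z Uz; apply: (@continuous_comp _ _ _ g (fun u : 'rV[R]_2 => u 0 j)).
    exact: cg.
  exact: coord_continuous.
move=> [dg Cg]; split=> [z Uz|v].
  by have [] := deriv_at_coord 0 j (dg z Uz).
apply: Cn_ext (IH _ (Cg v)) => // z Uz.
by have [_ ->] := deriv_at_coord v j (dg z Uz).
Qed.

Lemma derive_scalel (V W : normedModType R) (k : V -> R) (e : W) z v a :
  deriv_at k z v a ->
  differentiable (fun w => k w *: e) z /\ 'D_v (fun w => k w *: e) z = a *: e.
Proof.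
move=> [dk <-].
have dke : differentiable (fun w => k w *: e) z by exact: (differentiableZl _ dk).
split=> //; rewrite deriveE// [LHS](congr1 (fun F => F v) (diffZl e dk)) /=.
by rewrite deriveE.
Qed.

Lemma derive_rV2 (W : normedModType R) (g : 'rV[R]_2 -> W) x v : differentiable g x ->
  'D_v g x = v 0 0 *: 'D_(delta_mx 0 0) g x + v 0 1 *: 'D_(delta_mx 0 1) g x.
Proof. by move=> dg; rewrite !deriveE// {1}(row2E v) linearD !linearZ. Qed.

End VectorCalculus.

Lemma row2_entries (R : pzRingType) (a b : R) :
  let u : 'rV[R]_2 := a *: delta_mx 0 0 + b *: delta_mx 0 1 in u 0 0 = a /\ u 0 1 = b.
Proof. by rewrite /= !mxE /= !(mulr1, mulr0, addr0, add0r). Qed.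

Section CoordinateChange.
Context {R : realType}.
Local Notation TU := ('rV[R]_2 * 'rV[R]_2)%type.
Context {V : set 'rV[R]_2} {tau : 'rV[R]_2 -> 'rV[R]_2}
  (oV : open V) (stau : smooth_on V tau).
Implicit Types (z v : TU) (x : 'rV[R]_2) (i j k l : 'I_2).

Definition jac k j x : R := ('D_(delta_mx 0 k) tau) x 0 j.
Definition hess k l j x : R := ('D_(delta_mx 0 l) ('D_(delta_mx 0 k) tau)) x 0 j.

(** The map (x, y) -> (tau x, y^k d_k tau) induced on tangent vectors. The fibre part is expanded in
    the standard basis, so that its coefficients are differentiated as scalar functions. *)
Definition tangent_map z : TU := (tau z.1,
  (z.2 0 0 * jac 0 0 z.1 + z.2 0 1 * jac 1 0 z.1) *: delta_mx 0 0
  + (z.2 0 0 * jac 0 1 z.1 + z.2 0 1 * jac 1 1 z.1) *: delta_mx 0 1).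

(** Schwarz's theorem was proved for scalar functions, so it is applied to each component of tau. *)
Lemma hess_sym k l j x : V x -> hess k l j x = hess l k j x.
Proof.
move=> Vx.
have DD m n : 'D_(delta_mx 0 n) ('D_(delta_mx 0 m) (fun u => tau u 0 j)) x = hess m n j x.
  rewrite (@near_eq_derive _ _ _ _ (fun u => 'D_(delta_mx 0 m) tau u 0 j)).
    exact: (deriv_at_coord _ _ (smooth_on_differentiable (smooth_on_derive _ stau) Vx)).2.
  apply: near_eq_on oV Vx _ => u Vu.
  exact: (deriv_at_coord _ _ (smooth_on_differentiable stau Vu)).2.
by rewrite -!DD; exact: derive_comm (Cn_coord j oV (stau 2%N)) Vx.
Qed.

Lemma deriv_at_jac k j z v : V z.1 -> deriv_at (fun w : TU => jac k j w.1) z v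
  (v.1 0 0 * hess k 0 j z.1 + v.1 0 1 * hess k 1 j z.1).
Proof.
move=> Vz; have sk := smooth_on_derive (delta_mx 0 k) stau.
have dk := smooth_on_differentiable sk Vz.
have dg : differentiable (fun w : TU => ('D_(delta_mx 0 k) tau) w.1) z.
  exact: (differentiable_comp (differentiable_fst z) dk).
apply: deriv_at_eq (deriv_at_coord v j dg) _.
rewrite (derive_comp v (differentiable_fst z) dk) derive_fst (derive_rV2 _ dk).
by rewrite [LHS]mxE [X in X + _]mxE [X in _ + X]mxE.
Qed.

(* The fiber components of the derivative of [tangent_map] along v. *)
Definition tangent_map_deriv z v j : R :=
  v.2 0 0 * jac 0 j z.1 + z.2 0 0 * (v.1 0 0 * hess 0 0 j z.1 + v.1 0 1 * hess 0 1 j z.1)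
  + (v.2 0 1 * jac 1 j z.1 + z.2 0 1 * (v.1 0 0 * hess 1 0 j z.1 + v.1 0 1 * hess 1 1 j z.1)).

Lemma deriv_at_tangent_map (K : TU -> R) z v : V z.1 ->
  differentiable K (tangent_map z) ->
  deriv_at (fun w => K (tangent_map w)) z v (
    (v.1 0 0 * jac 0 0 z.1 + v.1 0 1 * jac 1 0 z.1) * dx 0 K (tangent_map z)
    + (v.1 0 0 * jac 0 1 z.1 + v.1 0 1 * jac 1 1 z.1) * dx 1 K (tangent_map z)
    + (tangent_map_deriv z v 0 * dy 0 K (tangent_map z)
       + tangent_map_deriv z v 1 * dy 1 K (tangent_map z))).
Proof.
move=> Vz dK.
have dtau := smooth_on_differentiable stau Vz.
have dt1 : differentiable (fun w : TU => tau w.1) z.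
  exact: (differentiable_comp (differentiable_fst z) dtau).
have D1 : 'D_v (fun w : TU => tau w.1) z = 'D_(v.1) tau z.1.
  by rewrite (derive_comp v (differentiable_fst z) dtau) derive_fst.
have c j : deriv_at (fun w : TU => w.2 0 0 * jac 0 j w.1 + w.2 0 1 * jac 1 j w.1) z v
    (tangent_map_deriv z v j).
  apply: deriv_atD; apply: deriv_atM (deriv_at_y _ _ _) (deriv_at_jac _ _ _ Vz).
have [d20 D20] := derive_scalel (delta_mx 0 0 : 'rV[R]_2) (c 0).
have [d21 D21] := derive_scalel (delta_mx 0 1 : 'rV[R]_2) (c 1).
have d2 := differentiableD d20 d21.
have dpsi : differentiable tangent_map z by exact: (differentiable_pair dt1 d2).
have Dpsi : 'D_v tangent_map z = ('D_(v.1) tau z.1,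
    tangent_map_deriv z v 0 *: delta_mx 0 0 + tangent_map_deriv z v 1 *: delta_mx 0 1).
  rewrite (derive_pair v dt1 d2) D1 [X in (_, X)]deriveD; [|exact: diff_derivable..].
  by rewrite D20 D21.
apply: deriv_at_eq (deriv_at_chain dpsi Dpsi dK) _.
have e1 j : ('D_(v.1) tau z.1) 0 j = v.1 0 0 * jac 0 j z.1 + v.1 0 1 * jac 1 j z.1.
  by rewrite (derive_rV2 _ dtau) [LHS]mxE [X in X + _]mxE [X in _ + X]mxE.
rewrite (derive_dxdy _ dK) [in LHS]/fst [in LHS]/snd !e1.
by have [-> ->] := row2_entries (tangent_map_deriv z v 0) (tangent_map_deriv z v 1).
Qed.

End CoordinateChange.
Arguments tangent_map {R} tau z.
Arguments jac {R} tau k j x.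
Arguments hess {R} tau k l j x.

Ltac gen_jets := repeat match goal with
  | |- context [jac ?t ?k ?j ?x] => generalize (jac t k j x); intro
  | |- context [hess ?t ?k ?l ?j ?x] => generalize (hess t k l j x); intro
  end.

(** * Covariance of the spray *)

Section SprayInvariance.
Context {R : realType}.
Local Notation TU := ('rV[R]_2 * 'rV[R]_2)%type.
Context {V : set 'rV[R]_2} {tau : 'rV[R]_2 -> 'rV[R]_2}
  (oV : open V) (stau : smooth_on V tau).
Context {U U' W : set TU} {F F' : TU -> R} (FF : finsler_on U F) (FF' : finsler_on U' F').
Context (oW : open W) (WU : W `<=` U) (WV : forall z, W z -> V z.1)
  (WU' : forall z, W z -> U' (tangent_map tau z))
  (FE : forall z, W z -> F z = F' (tangent_map tau z)).
Implicit Types (z v : TU) (x : 'rV[R]_2) (i j k l : 'I_2) (K : TU -> R).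
Local Notation L := (sqF F).
Local Notation L' := (sqF F').
Local Notation psi := (tangent_map tau).
Local Notation J k j z := (jac tau k j z.1).
Local Notation H k l j z := (hess tau k l j z.1).

Lemma dy_tangent_map K K' i z : smooth_on U' K' -> W z ->
  (forall w, W w -> K w = K' (psi w)) ->
  dy i K z = J i 0 z * dy 0 K' (psi z) + J i 1 z * dy 1 K' (psi z).
Proof.
move=> sK' Wz KE.
have dK' := smooth_on_differentiable sK' (WU' Wz).
have [_ D] := deriv_at_on oW Wz (fun w Ww => esym (KE w Ww))
  (deriv_at_tangent_map stau (0, delta_mx 0 i) (WV Wz) dK').
rewrite [LHS]D /tangent_map_deriv /=.
have e00 : (0 : 'rV[R]_2) 0 0 = 0 by rewrite mxE.
have e01 : (0 : 'rV[R]_2) 0 1 = 0 by rewrite mxE.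
have d0 : (delta_mx 0 i : 'rV[R]_2) 0 0 = (i == 0)%:R by rewrite mxE eqxx eq_sym.
have d1 : (delta_mx 0 i : 'rV[R]_2) 0 1 = (i == 1)%:R by rewrite mxE eqxx eq_sym.
rewrite e00 e01 d0 d1.
by case: (ord2P i) => ->; gen_jets; gen_atoms; rewrite /=; ring.
Qed.

(** The fibre components of [psi] also depend on x, which brings in the second derivatives of
    tau. *)
Lemma dx_tangent_map K K' i z : smooth_on U' K' -> W z ->
  (forall w, W w -> K w = K' (psi w)) ->
  dx i K z = J i 0 z * dx 0 K' (psi z) + J i 1 z * dx 1 K' (psi z)
   + ((z.2 0 0 * H 0 i 0 z + z.2 0 1 * H 1 i 0 z) * dy 0 K' (psi z)
      + (z.2 0 0 * H 0 i 1 z + z.2 0 1 * H 1 i 1 z) * dy 1 K' (psi z)).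
Proof.
move=> sK' Wz KE.
have dK' := smooth_on_differentiable sK' (WU' Wz).
have [_ D] := deriv_at_on oW Wz (fun w Ww => esym (KE w Ww))
  (deriv_at_tangent_map stau (delta_mx 0 i, 0) (WV Wz) dK').
rewrite [LHS]D /tangent_map_deriv /=.
have e00 : (0 : 'rV[R]_2) 0 0 = 0 by rewrite mxE.
have e01 : (0 : 'rV[R]_2) 0 1 = 0 by rewrite mxE.
have d0 : (delta_mx 0 i : 'rV[R]_2) 0 0 = (i == 0)%:R by rewrite mxE eqxx eq_sym.
have d1 : (delta_mx 0 i : 'rV[R]_2) 0 1 = (i == 1)%:R by rewrite mxE eqxx eq_sym.
rewrite e00 e01 d0 d1.
by case: (ord2P i) => ->; gen_jets; gen_atoms; rewrite /=; ring.
Qed.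

Lemma spray_derivE K z : differentiable K z -> spray_deriv F K z = 'D_(spray F z) K z.
Proof.
move=> dK; rewrite (derive_dxdy _ dK) /spray_deriv /spray /=.
have e j : (\row_i (- 2 * spray_coef F i z)) 0 j = - 2 * spray_coef F j z.
  by rewrite mxE.
by rewrite !e; move: (dx 0 K z) (dx 1 K z) (dy 0 K z) (dy 1 K z) (spray_coef F 0 z)
  (spray_coef F 1 z) => *; ring.
Qed.

#[local] Opaque dx dy spray_coef.

(** In this order of derivatives the first two terms differentiate the single function d.i E^2,
    whose transformation law is [dy_tangent_map]. *)
Lemma spray_rhs_sym (E : TU -> R) U0 i z : finsler_on U0 E -> U0 z -> spray_rhs E i z =
  z.2 0 0 * dx 0 (dy i (sqF E)) z + z.2 0 1 * dx 1 (dy i (sqF E)) z - dx i (sqF E) z.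
Proof.
move=> EE Uz; rewrite /spray_rhs.
have oU0 := finsler_open EE; have sE := sqF_smooth EE.
by move: (dy_dx i 0 oU0 sE Uz) (dy_dx i 1 oU0 sE Uz); gen_atoms => -> ->.
Qed.

(* The image of the spray of F under the derivative of [psi] satisfies the
   Euler-Lagrange equations of F', which determine the spray of F'. *)
Lemma spray_coef_tangent_map z : W z ->
  (forall l, exists r0 r1, forall j, r0 * J 0 j z + r1 * J 1 j z = (l == j)%:R) ->
  forall j, tangent_map_deriv (tau := tau) z (spray F z) j = - 2 * spray_coef F' j (psi z).
Proof.
move=> Wz inv.
set c := tangent_map_deriv z (spray F z).
suff GE j : spray_coef F' j (psi z) = - 2^-1 * c j.
  by move=> j; rewrite GE; field.
have Uz := WU Wz; have Uz' := WU' Wz.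
have sL' := sqF_smooth FF'.
have LE w : W w -> L w = L' (psi w) by move=> Ww; rewrite /sqF FE.
pose y j := z.2 0 0 * J 0 j z + z.2 0 1 * J 1 j z.
(* The Euler-Lagrange expression of L' taken along the image of the spray of F, with base components
   y and fibre components c. *)
pose X j := y 0 * dx 0 (dy j L') (psi z) + y 1 * dx 1 (dy j L') (psi z)
  + (c 0 * dy 0 (dy j L') (psi z) + c 1 * dy 1 (dy j L') (psi z)) - dx j L' (psi z).
(* In the Euler-Lagrange equation of L, second derivatives of tau arise from the Jacobian
   differentiated along S and from d_i L; [hess_sym] cancels them. *)
have JX i : J i 0 z * X 0 + J i 1 z * X 1 = 0.
  have E := spray_coefP i (finsler_det FF Uz).
  rewrite (spray_rhs_sym i FF Uz) (dx_tangent_map i sL' Wz LE) in E.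
  have sdy := smooth_dy i (sqF_smooth FF).
  have D0 := derive_dxdy (spray F z) (smooth_on_differentiable sdy Uz).
  have dL' j := smooth_on_differentiable (smooth_dy j sL') Uz'.
  have DJ j := deriv_atM (deriv_at_jac stau i j (spray F z) (WV Wz))
     (deriv_at_tangent_map stau (spray F z) (WV Wz) (dL' j)).
  have [_ D1] := deriv_at_on oW Wz
    (fun w Ww => esym (dy_tangent_map i sL' Ww LE)) (deriv_atD (DJ 0) (DJ 1)).
  rewrite D1 {D1 DJ} -/c in D0.
  have e n : (spray F z).2 0 n = - 2 * spray_coef F n z by rewrite /= mxE.
  rewrite !e in D0.
  move: D0 E; rewrite /X /y (hess_sym oV stau 0 i 0 (WV Wz)) (hess_sym oV stau 1 i 0 (WV Wz)).
  rewrite (hess_sym oV stau 0 i 1 (WV Wz)) (hess_sym oV stau 1 i 1 (WV Wz)) /=.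
  move: (dy_dy i 0 (finsler_open FF) (sqF_smooth FF) Uz).
  move: (dy_dy i 1 (finsler_open FF) (sqF_smooth FF) Uz).
  move: (c 0) (c 1); gen_jets; gen_atoms; move: (z.2 0 0) (z.2 0 1) => y0 y1 c0 c1 -> -> D0 E.
  lra.
have X0 l : X l = 0.
  have [r0 [r1 rE]] := inv l.
  transitivity (r0 * (J 0 0 z * X 0 + J 0 1 z * X 1) + r1 * (J 1 0 z * X 0 + J 1 1 z * X 1)).
    transitivity ((r0 * J 0 0 z + r1 * J 1 0 z) * X 0 + (r0 * J 0 1 z + r1 * J 1 1 z) * X 1).
      by rewrite !rE; case: (ord2P l) => ->; rewrite /= ?(mul1r, mul0r, addr0, add0r).
    by move: (X 0) (X 1) (J 0 0 z) (J 0 1 z) (J 1 0 z) (J 1 1 z) => *; ring.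
  transitivity (r0 * 0 + r1 * 0); last by rewrite !mulr0 addr0.
  by congr (_ * _ + _ * _); exact: JX.
move: j; apply: (spray_coef_unique (finsler_det FF' Uz')) => j.
have := X0 j; rewrite (spray_rhs_sym j FF' Uz') /X.
have [-> ->] : (psi z).2 0 0 = y 0 /\ (psi z).2 0 1 = y 1 by exact: row2_entries.
move: (dy_dy j 0 (finsler_open FF') sL' Uz') (dy_dy j 1 (finsler_open FF') sL' Uz').
move: (y 0) (y 1) (c 0) (c 1); gen_atoms => y0 y1 c0 c1 -> -> E.
lra.
Qed.

(** The differential of [psi] carries the spray of F to that of F', so the chain rule gives equal
    derivatives. *)
Lemma spray_deriv_tangent_map h h' z : smooth_on U h -> smooth_on U' h' ->
  (forall w, W w -> h w = h' (psi w)) -> W z ->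
  (forall l, exists r0 r1, forall j, r0 * J 0 j z + r1 * J 1 j z = (l == j)%:R) ->
  spray_deriv F h z = spray_deriv F' h' (psi z).
Proof.
move=> sh sh' hE Wz inv.
have Uz := WU Wz; have Uz' := WU' Wz.
rewrite (spray_derivE (smooth_on_differentiable sh Uz)).
have [_ ->] := deriv_at_on oW Wz (fun w Ww => esym (hE w Ww))
  (deriv_at_tangent_map stau (spray F z) (WV Wz) (smooth_on_differentiable sh' Uz')).
rewrite !(spray_coef_tangent_map Wz inv) /spray_deriv.
have [-> ->] : (psi z).2 0 0 = z.2 0 0 * J 0 0 z + z.2 0 1 * J 1 0 z /\
  (psi z).2 0 1 = z.2 0 0 * J 0 1 z + z.2 0 1 * J 1 1 z by exact: row2_entries.
rewrite /=; move: (J 0 0 z) (J 0 1 z) (J 1 0 z) (J 1 1 z).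
gen_atoms => *; ring.
Qed.

End SprayInvariance.

(** * Passage between charts of the surface *)

Section Charts.
Context {R : realType} {M : surface R}.
Implicit Types (a b : Defs.index M) (t : tangent M) (A : set (tangent M)) (f : tangent M -> R).

Definition overlap a b : set 'rV[R]_2 := Defs.coord a @` (dom a `&` dom b).

Lemma overlap_open a b : open (overlap a b).
Proof.
rewrite openE => _ [p [pa pb] <-].
have na : \forall x \near Defs.coord a p, (Defs.coord a @` dom a) x.
  by apply: open_nbhs_nbhs; split; [exact: image_open|exists p].
have nb : \forall x \near Defs.coord a p, dom b (param a x).
  apply: (@param_continuous _ M a (Defs.coord a p)); first by exists p.
  by rewrite coordK//; apply: open_nbhs_nbhs; split => //; exact: dom_open.
apply: filterS2 na nb => _ [q qa <-]; rewrite coordK// => qb.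
by exists q.
Qed.

Lemma tangent_map_tcoord a b t : dom a (base t) -> dom b (base t) ->
  tangent_map (transition a b) (tcoord a t) = tcoord b t.
Proof.
move=> ta tb; have dt := transition_differentiable ta tb.
congr pair; first by rewrite /= /transition /= coordK.
have -> : Defs.comp t b = 'D_(Defs.comp t a) (transition a b) (Defs.coord a (base t)).
  by rewrite (comp_transition ta tb) deriveE.
rewrite [RHS]row2E (derive_rV2 _ dt).
by congr (_ *: _ + _ *: _); rewrite [RHS]mxE; congr (_ + _); rewrite [RHS]mxE.
Qed.

(** The coefficients are the components of the differential of the opposite transition map, applied
    to the basis vector of index l. *)
Lemma jac_right_inverse a b t : dom a (base t) -> dom b (base t) ->
  forall l, exists r0 r1, forall j,
    r0 * jac (transition a b) 0 j (Defs.coord a (base t))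
    + r1 * jac (transition a b) 1 j (Defs.coord a (base t)) = (l == j)%:R.
Proof.
move=> ta tb l; have dt := transition_differentiable ta tb.
pose r : 'rV[R]_2 := 'd (transition b a) (Defs.coord b (base t)) (delta_mx 0 l).
exists (r 0 0), (r 0 1) => j.
have rE : 'D_r (transition a b) (Defs.coord a (base t)) = delta_mx 0 l.
  rewrite deriveE// -[RHS](transition_id _ tb).
  exact: esym (congr1 (fun g => g (delta_mx 0 l)) (transition_comp tb ta tb)).
have := congr1 (fun u : 'rV[R]_2 => u 0 j) rE.
rewrite (derive_rV2 _ dt) /= [LHS]mxE [X in X + _]mxE [X in _ + X]mxE => ->.
by rewrite mxE eqxx eq_sym.
Qed.

Lemma chart_finsler A f a : conic_pseudo_finsler A f -> (forall t, A t -> f t != 0) ->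
  finsler_on (chart_set a A) (chart_expr a f).
Proof.
move=> [[_ Ao _ _ Ak] fs fh fd] f0; split.
- exact: Ao.
- by move=> k _ k0 [t [At ta] <-]; exists (tscale k t) => //; split => //; exact: Ak.
- exact: fs.
- by move=> _ [t [At ta] <-]; rewrite chart_exprE//; exact: f0.
- move=> k _ k0 [t [At ta] <-].
  have -> : fiber_scale k (tcoord a t) = tcoord a (tscale k t) by [].
  by rewrite !chart_exprE// fh// expr1.
- exact: fd.
Qed.

Lemma chart_expr_hom0 A f a : homogeneous 0 A f -> 
  forall k z, 0 < k -> chart_set a A z ->
  chart_expr a f (fiber_scale k z) = chart_expr a f z.
Proof.
move=> fh k _ k0 [t [At ta] <-].
have -> : fiber_scale k (tcoord a t) = tcoord a (tscale k t) by [].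
by rewrite !chart_exprE// fh// expr0 mul1r.
Qed.

Lemma spray_deriv_chart A f h a b t : conic_pseudo_finsler A f ->
  (forall t, A t -> f t != 0) -> smooth_fun A h ->
  A t -> dom a (base t) -> dom b (base t) ->
  spray_deriv (chart_expr a f) (chart_expr a h) (tcoord a t) =
  spray_deriv (chart_expr b f) (chart_expr b h) (tcoord b t).
Proof.
move=> ff f0 sh At ta tb; rewrite -(tangent_map_tcoord ta tb).
(* The two chart expressions are compared by differentiation, so they must agree on an open set
   around the point: the part of A over the overlap, read in the chart a. *)
pose W := chart_set a A `&` (fun z => z.1) @^-1` overlap a b.
have Wt z : W z -> exists u, [/\ A u, dom a (base u), dom b (base u) & tcoord a u = z].
  move=> [[u [Au ua] <-] [p [pa pb] /= pu]]; exists u; split => //.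
  by rewrite -(coordK ua) -pu coordK.
have oW : open W.
  apply: openI; first by case: ff => -[].
  apply: (@open_comp _ _ (fun z : 'rV[R]_2 * 'rV[R]_2 => z.1)); last exact: overlap_open.
  by move=> z _; exact: cvg_fst.
have E f' z : W z -> chart_expr a f' z = chart_expr b f' (tangent_map (transition a b) z).
  by move=> /Wt[u [Au ua ub <-]]; rewrite tangent_map_tcoord// !chart_exprE.
apply: (spray_deriv_tangent_map (V := overlap a b) (W := W) _ _
  (chart_finsler a ff f0) (chart_finsler b ff f0)) => //.
- exact: overlap_open.
- exact: transition_smooth.
- by move=> z [].
- by move=> z [].
- by move=> z /Wt[u [Au ua ub <-]]; rewrite tangent_map_tcoord//; exists u.
- by move=> z; exact: E.
- by move=> z; exact: E.
- by split; [exists t|exists (base t)].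
- exact: jac_right_inverse.
Qed.

End Charts.

Lemma spray_snd (R : realType) (f : 'rV[R]_2 * 'rV[R]_2 -> R) z j :
  (spray f z).2 0 j = - 2 * spray_coef f j z.
Proof. by rewrite /= mxE. Qed.

Lemma sub_vertical_snd (R : realType) (u v : 'rV[R]_2 * 'rV[R]_2) (c : R) j :
  (u - c *: (0, v.2)).2 0 j = u.2 0 j - c * v.2 0 j.
Proof. by rewrite /= !mxE. Qed.

Lemma proportional_sprayP (R : realType) (f g : 'rV[R]_2 * 'rV[R]_2 -> R) z (c : R) :
  spray g z = spray f z - (2 * c) *: (0, z.2) <->
  forall j, spray_coef g j z = spray_coef f j z + c * z.2 0 j.
Proof.
split=> [E j|E].
  have := congr1 (fun v : 'rV[R]_2 * 'rV[R]_2 => v.2 0 j) E.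
  rewrite sub_vertical_snd !spray_snd; move: (spray_coef g j z) (spray_coef f j z).
  by move=> a b ab; lra.
rewrite [LHS]surjective_pairing [RHS]surjective_pairing; congr pair.
  by rewrite /= scaler0 oppr0 addr0.
apply/rowP => j; rewrite spray_snd [RHS]sub_vertical_snd spray_snd E.
by move: (spray_coef f j z) => a; ring.
Qed.

(** * The global projective factor and the equivalences *)

Section MainTheorem.
Context {R : realType} {M : surface R} {A : set (tangent M)} {F phi : tangent M -> R}
  (F_finsler : conic_pseudo_finsler A F) (F_neq0 : forall t, A t -> F t != 0)
  (phi_smooth : smooth_fun A phi) (phi_hom : homogeneous 0 A phi).
Implicit Types (a : Defs.index M) (t : tangent M).

Definition base_chart (p : M) : Defs.index M := sval (cid (dom_cover p)).

(** T / 2 read in an arbitrarily chosen chart around the base point; by covariance of the spray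
    every other chart gives the same value on A ([projective_factorE]). *)
Definition projective_factor t : R :=
  let a := base_chart (base t) in
  2^-1 * spray_deriv (chart_expr a F) (chart_expr a phi) (tcoord a t).

Lemma projective_factorE a t : A t -> dom a (base t) ->
  projective_factor t = 2^-1 * spray_deriv (chart_expr a F) (chart_expr a phi) (tcoord a t).
Proof.
move=> At ta; congr (_ * _); apply: (spray_deriv_chart F_finsler) => //.
exact: svalP (cid (dom_cover (base t))).
Qed.

Lemma projective_factor_hom : homogeneous 1 A projective_factor.
Proof.
move=> k t k0 At; rewrite /projective_factor mulrCA; congr (_ * _).
set a := base_chart (base t).
have ta : dom a (base t) := svalP (cid (dom_cover (base t))).
have Uz : chart_set a A (tcoord a t) by exists t.
exact: (spray_deriv_hom (chart_finsler a F_finsler F_neq0) (n := 0) k0 (phi_smooth a) Uz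
  (fun w Uw => etrans (chart_expr_hom0 phi_hom k0 Uw) (esym (mul1r _)))).
Qed.

End MainTheorem.

Theorem theorem4p2 (R : realType) (M : surface R) (A : set (tangent M))
    (F phi : tangent M -> R)
    (F_finsler : conic_pseudo_finsler A F)
    (F_neq0 : forall t, A t -> F t != 0)
    (phi_smooth : smooth_fun A phi)
    (phi_homogeneous : homogeneous 0 A phi)
    (sigma_neq0 : forall a z, chart_set a A z ->
      let f := chart_expr a F in
      let h := chart_expr a phi in
      sigma f h z + signature f z - semi2 f h z ^+ 2 != 0) :
  let Fbar := conformal_change F phi in
  let assertion_i := projectively_equivalent A F Fbar in
  let assertion_ii := forall a z, chart_set a A z ->
    let f := chart_expr a F in
    let h := chart_expr a phi in
    semi2 f h z * comma1 f h z + semi2 f (comma1 f h) z = 2 * comma2 f h z in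
  let assertion_iii := forall a z, chart_set a A z ->
    let f := chart_expr a F in
    let h := chart_expr a phi in
    forall i : 'I_2,
      spray_coef (chart_expr a Fbar) i z =
      spray_coef f i z + 2^-1 * f z * comma1 f h z * z.2 ord0 i in
  (assertion_i <-> assertion_ii) /\ (assertion_ii <-> assertion_iii).

Proof.
move=> Fbar i_ ii_ iii_.
have FF a := chart_finsler a F_finsler F_neq0.
have h_hom a := @chart_expr_hom0 _ _ _ _ a phi_homogeneous.
have FbE a z : chart_set a A z ->
    chart_expr a Fbar z = expR (chart_expr a phi z) * chart_expr a F z.
  by move=> [t [At ta] <-]; rewrite !chart_exprE.
have FFb a := conformal_finsler (FF a) (phi_smooth a) (h_hom a) (FbE a) (@sigma_neq0 a).
have ii_iii : ii_ <-> iii_.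
  by split=> H a z Uz; apply/(assertion_ii_iii (FF a) (phi_smooth a) (h_hom a) (FbE a) (FFb a) Uz);
    exact: H.
have comma1T a z : chart_set a A z -> 2^-1 * chart_expr a F z *
    comma1 (chart_expr a F) (chart_expr a phi) z =
    2^-1 * spray_deriv (chart_expr a F) (chart_expr a phi) z.
  move=> Uz; rewrite (comma1E (FF a))// -mulrA; congr (_ * _).
  by rewrite mulrC divfK// (finsler_neq0 (FF a)).
split=> //; split=> [[P _ PE]|/ii_iii iii].
  apply/ii_iii => a z Uz f h i; rewrite comma1T//.
  have GE j : spray_coef (chart_expr a Fbar) j z =
      spray_coef f j z + chart_expr a P z * z.2 0 j.
    by move/proportional_sprayP: (PE a z Uz); exact.
  by rewrite GE (proportional_spray (FF a) (phi_smooth a) (h_hom a) (FbE a) (FFb a) Uz GE).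
exists (projective_factor (F := F) (phi := phi)).
  exact: (projective_factor_hom F_finsler).
move=> a z Uz; have GE := iii a z Uz; move: Uz GE => [t [At ta] <-] GE.
rewrite chart_exprE// (projective_factorE F_finsler F_neq0 phi_smooth At ta).
have Uz : chart_set a A (tcoord a t) by exists t.
by apply/proportional_sprayP => j; rewrite GE comma1T.
Qed.
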